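(* Let $n\ge 2$ and let $u$ be a smooth, parabolically convex solution to \[ -u_t\cdot\det D^2u=1\quad\text{in }\mathbb R^{n+1}_-:=\mathbb R^n\times(-\infty,0] \] of variable separated form \[ u(x,t)=w(t)\cdot\varphi(|x|),\quad\forall~(x,t)\in\mathbb R^{n+1}_-. \] Then up to a re-scaling and transformation, $u=u_1$ (the solution defined in the context) and we have \[ w(t)=(n+1)^{\frac{1}{n+1}}(-t)^{\frac{1}{n+1}}\quad\text{and}\quad \lim_{r\to\infty}\frac{\varphi(r)}{r^{\frac{2n}{n+1}}}=\frac{n+1}{(2n)^{\frac{n}{n+1}}(n-1)^{\frac{1}{n+1}}}, \] i.e., for any $t<0$, \[ \frac{u(x,t)}{u_0(x,t)}\to 1\quad\text{as }|x|\to\infty, \qquad\text{where}\quad u_0(x,t)=\left(\frac{(n+1)^{n+2}}{(2n)^n(n-1)}\right)^{\frac{1}{n+1}}(-t)^{\frac{1}{n+1}}|x|^{\frac{2n}{n+1}}. \] The derivatives of $\varphi$ share similar asymptotic behavior: \[ \lim_{r\to\infty}\frac{\varphi'(r)}{\frac{2n}{n+1}r^{\frac{n-1}{n+1}}} =\lim_{r\to\infty}\frac{\varphi''(r)}{\frac{2n(n-1)}{(n+1)^2}r^{\frac{-2}{n+1}}} =\frac{n+1}{(2n)^{\frac{n}{n+1}}(n-1)^{\frac{1}{n+1}}}. \]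
   Context: $u_t$ is the derivative in the time variable $t$ and $D^2u$ is the Hessian in $x$. A function $u:\mathbb R^{n+1}_-\to\mathbb R$ is called parabolically convex if it is continuous, convex in $x$ and non-increasing in $t$. The solution $u_1$ is $u_1(x,t):=(-(n+1)t)^{\frac{1}{n+1}}\varphi_1(|x|)$, where $\varphi_1$ is the monotone non-decreasing solution on $[0,\infty)$ of \[ (\varphi_1'(r))^n=n\int_0^r\frac{s^{n-1}}{\varphi_1(s)}\,\mathrm ds\quad(r>0),\qquad \varphi_1(0)=1 . \] Re-scaling and transformation: for a separated solution there is a constant $C>0$ with $-w'w^n=C$ and $\varphi\,\varphi''(\varphi'/r)^{n-1}=C^{-1}$. One reduces to $C=1$ by replacing $(w,\varphi)$ with $(C^{-\frac1{n+1}}w,\,C^{\frac1{n+1}}\varphi)$, which does not change $u$, and, up to a transformation in the $t$-variable and the value of $u$, to $w(0)=0$ and $\varphi(0)=1$. The formula for $w$ and the limits are for $w,\varphi$ after this normalization. *)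

(* Defs.v *)
From HB Require Import structures.
From mathcomp Require Import all_boot all_order all_algebra.
From mathcomp Require Import all_classical all_reals all_analysis.

Set Implicit Arguments.
Unset Strict Implicit.
Unset Printing Implicit Defensive.

Import Order.TTheory GRing.Theory Num.Theory.
Import numFieldNormedType.Exports.

Local Open Scope ring_scope.
Local Open Scope classical_set_scope.

(* The library norm `|x| on 'rV[R]_n is the sup norm. *)
Definition enorm (R : realType) (n : nat) (x : 'rV[R]_n) : R :=
  Num.sqrt (\sum_(i < n) x 0 i ^+ 2).

Definition at_infinity (R : realType) (n : nat) : set_system 'rV[R]_n :=
  filter_from setT (fun M : R => [set x | M < enorm x]).

(* On a finite-dimensional V and an open A this is the usual class C^k(A):
   existence and continuity of all iterated directional derivatives of
   order at most k. *)
Fixpoint Ck_on (R : realType) (V : normedModType R) (k : nat) (A : set V)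
    (f : V -> R) : Prop :=
  {in A, continuous f} /\
  if k is k'.+1 then
    forall v : V, (forall x, A x -> derivable f x v) /\ Ck_on k' A ('D_v f)
  else True.

Definition smooth_on (R : realType) (V : normedModType R) (A : set V)
    (f : V -> R) : Prop :=
  forall k, Ck_on k A f.

(* Functions on R^n x (-oo, 0] are represented by total functions on
   'rV[R]_n * R whose values at t > 0 are never used. *)
Definition parabolically_convex (R : realType) (n : nat)
    (u : 'rV[R]_n * R -> R) : Prop :=
  [/\ {within [set p : 'rV[R]_n * R | p.2 <= 0], continuous u},
      forall t : R, t <= 0 ->
        convex_function [set: 'rV[R]_n] (fun x => u (x, t))
    & forall (x : 'rV[R]_n) (s t : R), s <= t -> t <= 0 -> u (x, t) <= u (x, s)].

Definition dt (R : realType) (n : nat) (u : 'rV[R]_n * R -> R)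
    (x : 'rV[R]_n) (t : R) : R :=
  derive1 (fun s : R => u (x, s)) t.

Definition hessian (R : realType) (n : nat) (u : 'rV[R]_n * R -> R)
    (x : 'rV[R]_n) (t : R) : 'M[R]_n :=
  \matrix_(i, j)
    'D_(delta_mx 0 i) ('D_(delta_mx 0 j) (fun y : 'rV[R]_n => u (y, t))) x.

(* The equation is imposed at t < 0 only: separated solutions such as u1 below
   are continuous, but not differentiable in t, at t = 0. *)
Definition parabolic_MA_solution (R : realType) (n : nat)
    (u : 'rV[R]_n * R -> R) : Prop :=
  forall (x : 'rV[R]_n) (t : R), t < 0 -> - dt u x t * \det (hessian u x t) = 1.

Definition separated_fun (R : realType) (n : nat) (w phi : R -> R) :
    'rV[R]_n * R -> R :=
  fun p => w p.2 * phi (enorm p.1).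

Definition is_phi1 (R : realType) (n : nat) (phi : R -> R) : Prop :=
  [/\ {within `[0, +oo[%classic, continuous phi},
      {in `[0, +oo[ &, {homo phi : r s / r <= s}},
      phi 0 = 1
    & forall r : R, 0 < r -> derivable phi r 1 /\
        derive1 phi r ^+ n
        = n%:R * \int[@lebesgue_measure R]_(s in `[0, r]) (s ^+ n.-1 / phi s)].

Definition u1 (R : realType) (n : nat) (phi1 : R -> R) : 'rV[R]_n * R -> R :=
  separated_fun (fun t => (- (n.+1%:R * t)) `^ n.+1%:R^-1) phi1.

Definition u0 (R : realType) (n : nat) : 'rV[R]_n * R -> R :=
  fun p =>
    (n.+1%:R ^+ n.+2 / ((2 * n%:R) ^+ n * (n%:R - 1))) `^ n.+1%:R^-1
    * (- p.2) `^ n.+1%:R^-1 * enorm p.1 `^ (2 * n%:R / n.+1%:R).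

Definition phi_asymp_const (R : realType) (n : nat) : R :=
  n.+1%:R / ((2 * n%:R) `^ (n%:R / n.+1%:R) * (n%:R - 1) `^ n.+1%:R^-1).

Definition separation_equations (R : realType) (n : nat) (C : R)
    (w phi : R -> R) : Prop :=
  (forall t : R, t < 0 -> derivable w t 1 /\ - derive1 w t * w t ^+ n = C) /\
  (forall r : R, 0 < r ->
     [/\ derivable phi r 1, derivable (derive1 phi) r 1
       & phi r * derive1 (derive1 phi) r * (derive1 phi r / r) ^+ n.-1 = C^-1]).

(* (wN, phiN) is obtained from (w, phi) by
   - replacing (w, phi) with (- w, - phi) if s holds, and then with
     (C^(-1/(n+1)) w, C^(1/(n+1)) phi); neither changes the product;
   - the symmetry u(x, t) |-> a^-1 u(b x, t + T) of -u_t det D^2 u = 1, which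
     requires a^(n+1) = b^(2n).
   As t - T ranges over (-oo, -T] only, wN extends the translate of w. *)
Definition normalization (R : realType) (n : nat) (s : bool) (C a b T : R)
    (w phi wN phiN : R -> R) : Prop :=
  [/\ 0 < C /\
      separation_equations n C (fun t => (-1) ^+ s * w t)
                               (fun r => (-1) ^+ s * phi r),
      [/\ 0 < a, 0 < b, 0 <= T & a ^+ n.+1 = b ^+ (2 * n)],
      forall t : R, t <= 0 ->
        wN (t - T) = C `^ (- n.+1%:R^-1) * ((-1) ^+ s * w t),
      forall r : R, 0 <= r ->
        phiN r = a^-1 * (C `^ n.+1%:R^-1 * ((-1) ^+ s * phi (b * r)))
    & wN 0 = 0 /\ phiN 0 = 1].

(* Main.v *)
Require Import Defs.
From HB Require Import structures.
From mathcomp Require Import all_boot all_order all_algebra.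
From mathcomp Require Import all_classical all_reals all_analysis.
From mathcomp Require Import ring lra.

Set Implicit Arguments.
Unset Strict Implicit.
Unset Printing Implicit Defensive.

Import Order.TTheory GRing.Theory Num.Theory.
Import numFieldNormedType.Exports.

Local Open Scope ring_scope.
Local Open Scope classical_set_scope.

(** Separating variables turns the equation into - w' w ^ n = C and
    phi phi'' (phi' / r) ^ (n - 1) = 1 / C, because the Hessian of a radial
    function on a coordinate axis is diagonal with entries phi'' and phi' / r
    ([det_hessian_radial]).  After a choice of sign making w positive, convexity
    forces phi > 0 and C > 0 ([separation_constant]).  The equation for w says that
    w ^ (n + 1) is affine in t ([time_factor]).  The symmetries of the equation then
    reduce phi to the case C = 1, phi 0 = 1; as phi extends to a smooth even
    function, phi' vanishes at 0, and the profile equation integrates to the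
    integral equation defining phi_1 ([profile_is_phi1]).  Solutions of the latter
    are unique by a Gronwall argument ([is_phi1_unique]), where the degeneracy of
    phi' ^ n at 0 is compensated by a lower bound phi' >= r / K.

    For the behaviour at infinity, consider the logarithmic derivatives
    A = r phi' / phi and B = r phi'' / phi' as functions of s = ln r.  They solve
    the Lotka-Volterra system
      dA/ds = A ((B - be) - (A - al)),   dB/ds = B (- (A - al) - n (B - be)),
    whose equilibrium is al = 2 n / (n + 1), be = (n - 1) / (n + 1).  The sum V of
    the relative entropies of A with respect to al and of B with respect to be
    satisfies dV/ds = - (A - al) ^ 2 - n (B - be) ^ 2, and it bounds A and B away
    from 0, which yields dV/ds <= - k V and hence V -> 0 ([lyapunov_decay]).  So
    A -> al and B -> be, which gives all three limits, because
    phi ^ (n + 1) = r ^ (2 n) / (B A ^ n), phi' = A phi / r and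
    phi'' = A B phi / r ^ 2. *)

(** * Derivation rules for functions of one variable *)

Section Derivation.
Variable R : realType.
Implicit Types (f g : R -> R) (x a b : R).

(** Unlike is_derive, this is not a class: type class resolution would leave an
    unpredictable set of subgoals when the rules below are applied. *)
Definition der1 f x a := is_derive x 1 f a.

Lemma der1_eq f x a b : der1 f x a -> a = b -> der1 f x b.
Proof. by move=> df <-. Qed.

Lemma der1_cst (c x : R) : der1 (fun=> c) x 0.
Proof. exact: is_derive_cst. Qed.

Lemma der1_id x : der1 (fun y : R => y) x 1.
Proof. exact: is_derive_id. Qed.

Lemma der1D f g x a b : der1 f x a -> der1 g x b ->
  der1 (fun y => f y + g y) x (a + b).
Proof. exact: is_deriveD. Qed.

Lemma der1N f x a : der1 f x a -> der1 (fun y => - f y) x (- a).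
Proof. exact: is_deriveN. Qed.

Lemma der1M f g x a b : der1 f x a -> der1 g x b ->
  der1 (fun y => f y * g y) x (f x * b + g x * a).
Proof. exact: is_deriveM. Qed.

Lemma der1X f n x a : der1 f x a ->
  der1 (fun y => f y ^+ n) x (n%:R * f x ^+ n.-1 * a).
Proof. by move=> df; have := is_deriveX n df; rewrite exprfctE. Qed.

Lemma der1V f x a : f x != 0 -> der1 f x a ->
  der1 (fun y => (f y)^-1) x (- a / f x ^+ 2).
Proof.
move=> fx0 [df <-]; split; first exact: derivableV.
by rewrite deriveV//= [LHS]mulrC mulrN mulNr.
Qed.

Lemma der1_comp f g x a b : der1 g x b -> der1 f (g x) a ->
  der1 (fun y => f (g y)) x (a * b).
Proof. by move=> dg df; exact: is_derive1_comp. Qed.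

Lemma der1_scale f c b x a : der1 f (b * x) a ->
  der1 (fun y => c * f (b * y)) x (c * b * a).
Proof.
move=> df; apply: der1_eq.
  apply: der1M; first exact: der1_cst.
  by apply: der1_comp df; apply: der1M; [exact: der1_cst|exact: der1_id].
by rewrite /= !mulr0 !addr0 mulr1 [a * b]mulrC mulrA.
Qed.

Lemma der1_ln f x a : 0 < f x -> der1 f x a ->
  der1 (fun y => ln (f y)) x (a / f x).
Proof.
move=> fx0 df; rewrite mulrC; apply: der1_comp df _; exact: is_derive1_ln.
Qed.

Lemma der1_expR f x a : der1 f x a ->
  der1 (fun y => expR (f y)) x (expR (f x) * a).
Proof. by move=> df; apply: der1_comp df _; exact: is_derive_expR. Qed.

Lemma der1E f x a : der1 f x a -> derive1 f x = a.
Proof. by move=> [_ <-]; rewrite derive1E. Qed.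

Lemma derivable_der1 f x : derivable f x 1 -> der1 f x (derive1 f x).
Proof. by move=> /derivableP; rewrite derive1E. Qed.

Lemma der1_continuous f x a : der1 f x a -> {for x, continuous f}.
Proof. by move=> [df _]; exact/differentiable_continuous/derivable1_diffP. Qed.

Lemma near_der1 f g x a : (\forall y \near x, f y = g y) -> der1 f x a ->
  der1 g x a.
Proof. exact: near_eq_is_derive. Qed.

End Derivation.

Section Comparison.
Variable R : realType.
Implicit Types f g : R -> R.

Lemma der1_ge0_le f f' a b : a <= b -> {within `[a, b], continuous f} ->
  (forall x, a < x < b -> der1 f x (f' x)) ->
  (forall x, a < x < b -> 0 <= f' x) -> f a <= f b.
Proof.
move=> ab cf df f'ge0; apply: (@ger0_derive1_le_cc _ f a b) => //.
- by move=> x; rewrite in_itv/= => /df[].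
- by move=> x; rewrite in_itv/= => xab; rewrite (der1E (df _ xab)) f'ge0.
- by rewrite in_itv/= lexx.
- by rewrite in_itv/= lexx ab.
Qed.

Lemma der1_le f g f' g' a b : a <= b ->
  {within `[a, b], continuous f} -> {within `[a, b], continuous g} ->
  (forall x, a < x < b -> der1 f x (f' x)) ->
  (forall x, a < x < b -> der1 g x (g' x)) ->
  (forall x, a < x < b -> f' x <= g' x) -> f b - f a <= g b - g a.
Proof.
move=> ab cf cg df dg f'g'.
suff : g a - f a <= g b - f b by lra.
apply: (@der1_ge0_le (fun x => g x - f x) (fun x => g' x - f' x)) => // [x|x xab|x xab].
- by apply: continuousB; [exact: cg|exact: cf].
- by apply: der1D; [exact: dg|apply: der1N; exact: df].
- by rewrite subr_ge0 f'g'.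
Qed.

Lemma der1_le_norm f g f' g' a b : a <= b ->
  {within `[a, b], continuous f} -> {within `[a, b], continuous g} ->
  (forall x, a < x < b -> der1 f x (f' x)) ->
  (forall x, a < x < b -> der1 g x (g' x)) ->
  (forall x, a < x < b -> `|f' x| <= g' x) -> `|f b - f a| <= g b - g a.
Proof.
move=> ab cf cg df dg f'g'; rewrite ler_norml; apply/andP; split.
- suff : - f b - - f a <= g b - g a by lra.
  apply: (@der1_le (fun x => - f x) g (fun x => - f' x) g') => // [x|x xab|x xab].
  + by apply: continuousN; exact: cf.
  + by apply: der1N; exact: df.
  + by have := f'g' _ xab; rewrite ler_norml => /andP[? ?]; lra.
- apply: (@der1_le f g f' g') => // x xab.
  by have := f'g' _ xab; rewrite ler_norml => /andP[? ?]; lra.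
Qed.

Lemma der1_within_continuous f f' (a b : R) :
  (forall x, a <= x <= b -> der1 f x (f' x)) ->
  {within `[a, b], continuous f}.
Proof.
move=> df; apply: derivable_within_continuous => x; by rewrite in_itv/= => /df[].
Qed.

End Comparison.

(** * Asymptotics of the normalized profile equation *)

Lemma near_cvg (R : realType) (T : Type) (F : set_system T) {FF : Filter F}
    (g h : T -> R) (l : R) : (\forall x \near F, g x = h x) ->
  g x @[x --> F] --> l -> h x @[x --> F] --> l.
Proof. by move=> gh; apply: cvg_trans; exact: near_eq_cvg. Qed.
Arguments near_cvg {R T F FF} g {h l} _ _.

Section LyapunovFunction.
Variable R : realType.
Implicit Types a x : R.

(** The relative entropy x - a - a ln (x / a), which measures the distance of
    x to a and is the building block of Lyapunov functions of Lotka-Volterra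
    systems. *)
Definition entropy a x : R := x - a - a * ln (x / a).

Lemma der1_entropy a x : 0 < a -> 0 < x ->
  der1 (entropy a) x ((x - a) / x).
Proof.
move=> a0 x0; have xa0 : 0 < x / a by rewrite divr_gt0.
rewrite /entropy; apply: der1_eq.
  apply: der1D; first by apply: der1D; [exact: der1_id|exact: der1_cst].
  apply: der1N; apply: der1M; first exact: der1_cst.
  apply: der1_ln; first exact: xa0.
  apply: der1M; first exact: der1_id.
  exact: der1_cst.
by rewrite /=; field; rewrite !gt_eqF.
Qed.

(** ln (x / a) = 2 ln (sqrt (x / a)) <= 2 (sqrt (x / a) - 1). *)
Lemma entropy_ge_sqrt a x : 0 < a -> 0 < x ->
  a * (Num.sqrt (x / a) - 1) ^+ 2 <= entropy a x.
Proof.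
move=> a0 x0; have xa0 : 0 < x / a by rewrite divr_gt0.
set s := Num.sqrt (x / a).
have s0 : 0 < s by rewrite sqrtr_gt0.
have xas : x / a = s ^+ 2 by rewrite sqr_sqrtr// ltW.
have xE : x = a * s ^+ 2 by rewrite -xas mulrC divfK// gt_eqF.
have lns : ln s <= s - 1.
  by have := @le_ln1Dx _ (s - 1); rewrite subrKC; apply; lra.
rewrite /entropy xas lnXn// xE.
rewrite -subr_ge0 (_ : _ - _ = 2 * a * (s - 1 - ln s)); last by ring.
by rewrite mulr_ge0 ?subr_ge0// mulr_ge0// ltW.
Qed.

Lemma entropy_ge0 a x : 0 < a -> 0 < x -> 0 <= entropy a x.
Proof.
move=> a0 x0; apply: le_trans (entropy_ge_sqrt a0 x0).
by rewrite mulr_ge0 ?sqr_ge0// ltW.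
Qed.

(** ln (x / a) = - ln (a / x) >= 1 - a / x. *)
Lemma entropy_le a x : 0 < a -> 0 < x -> entropy a x <= (x - a) ^+ 2 / x.
Proof.
move=> a0 x0; have ax0 : 0 < a / x by rewrite divr_gt0.
have : ln (a / x) <= a / x - 1.
  by have := @le_ln1Dx _ (a / x - 1); rewrite subrKC; apply; lra.
rewrite -invf_div lnV ?posrE ?divr_gt0// invf_div => lnle.
have -> : (x - a) ^+ 2 / x = x - a - a * (1 - a / x).
  by field; rewrite gt_eqF.
rewrite /entropy lerD2l lerN2 ler_pM2l//; lra.
Qed.

(** The term - a ln (x / a) is unbounded above near x = 0. *)
Lemma entropy_bounded a M : 0 < a ->
  exists2 m, 0 < m & forall x, 0 < x -> entropy a x <= M -> m <= x.
Proof.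
move=> a0; exists (a * expR (- (M / a) - 1)); first by rewrite mulr_gt0 ?expR_gt0.
move=> x x0; rewrite /entropy => eM.
have xa0 : 0 < x / a by rewrite divr_gt0.
suff : expR (- (M / a) - 1) <= x / a by rewrite ler_pdivlMr// mulrC.
rewrite -[leRHS]lnK ?posrE// ler_expR.
rewrite -(ler_pM2l a0) mulrBr mulr1 mulrN mulrCA mulfV ?gt_eqF// mulr1; lra.
Qed.

Lemma entropy_cvg (T : Type) (F : set_system T) {FF : Filter F} (h : T -> R) a :
  0 < a -> (\forall y \near F, 0 < h y) -> entropy a (h y) @[y --> F] --> 0 ->
  h y @[y --> F] --> a.
Proof.
move=> a0 h0 eh0; pose s y := Num.sqrt (h y / a).
have s2 : (s y - 1) ^+ 2 @[y --> F] --> (0 : R).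
  apply: (@squeeze_cvgr _ _ _ _ (fun=> 0) (fun y => a^-1 * entropy a (h y))).
  - near=> y; have hy : 0 < h y by near: y; exact: h0.
    rewrite sqr_ge0/= mulrC ler_pdivlMr// mulrC.
    exact: entropy_ge_sqrt.
  - exact: cvg_cst.
  - by rewrite -[X in _ --> X](mulr0 a^-1); apply: cvgM => //; exact: cvg_cst.
have s1 : `|s y - 1| @[y --> F] --> (0 : R).
  under eq_fun do rewrite -sqrtr_sqr.
  by have := cvg_comp _ _ s2 (@sqrt_continuous R 0); rewrite sqrtr0.
have s1' : s y @[y --> F] --> (1 : R).
  by apply/subr_cvg0/norm_cvg0P.
have lim : a * (s y * s y) @[y --> F] --> a * (1 * 1).
  by apply: cvgM; [exact: cvg_cst|exact: cvgM].
rewrite !mulr1 in lim; apply: (near_cvg _ _ lim); near=> y.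
have hy : 0 < h y by near: y; exact: h0.
by rewrite /= -expr2 sqr_sqrtr ?divr_ge0 ?ltW// mulrC divfK// gt_eqF.
Unshelve. all: by end_near. Qed.

End LyapunovFunction.

Lemma cvg_ln_pinfty (R : realType) : @ln R r @[r --> +oo] --> +oo.
Proof.
apply/cvgryPge => M; near=> r.
have r0 : expR M <= r by near: r; exact: nbhs_pinfty_ge.
by rewrite -[M]expRK ler_ln ?posrE ?expR_gt0// (lt_le_trans _ r0) ?expR_gt0.
Unshelve. all: by end_near. Qed.

Lemma cvg_powR (R : realType) (T : Type) (F : set_system T) {FF : Filter F}
    (h : T -> R) (a p : R) :
  0 < a -> h x @[x --> F] --> a -> h x `^ p @[x --> F] --> a `^ p.
Proof.
move=> a0 ha; have [dp _] := is_derive1_powR p a0.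
have cp : {for a, continuous (fun x => x `^ p)}.
  exact/differentiable_continuous/derivable1_diffP.
exact: cvg_comp ha cp.
Qed.

Section ProfileAsymptotics.
Variables (R : realType) (n : nat) (f f1 f2 : R -> R).

(** The profile equation phi phi'' (phi' / r) ^ (n - 1) = K for r > 0, together
    with the signs that a convex positive profile has. *)
Definition profile_equation (K : R) := forall r : R, 0 < r ->
  [/\ der1 f r (f1 r), der1 f1 r (f2 r), 0 < f r, 0 < f1 r
    & f r * f2 r * (f1 r / r) ^+ n.-1 = K].

Hypotheses (n_ge2 : (2 <= n)%N) (feq : profile_equation 1).

Definition growth_exponent : R := 2 * n%:R / n.+1%:R.
Definition slope_exponent : R := (n%:R - 1) / n.+1%:R.
Local Notation al := growth_exponent.
Local Notation be := slope_exponent.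

(** The logarithmic derivatives of phi and of phi' with respect to ln r.  The
    equation is used to write the second one without phi''. *)
Definition elasticity r := r * f1 r / f r.
Definition slope_elasticity r := r ^+ n / (f r * f1 r ^+ n).
Local Notation A := elasticity.
Local Notation B := slope_elasticity.

Lemma growth_exponent_gt0 : 0 < al.
Proof. by rewrite divr_gt0 ?mulr_gt0 ?ltr0n// ltnW. Qed.

Lemma slope_exponent_gt0 : 0 < be.
Proof. by rewrite divr_gt0 ?subr_gt0 ?ltr1n ?ltr0n. Qed.

Lemma growth_exponentE : al = be + 1.
Proof.
rewrite /growth_exponent /slope_exponent -natr1.
by field; rewrite nat1r pnatr_eq0.
Qed.

Lemma exponents_sum : al + n%:R * be = n%:R.
Proof.
rewrite /growth_exponent /slope_exponent -natr1.
by field; rewrite nat1r pnatr_eq0.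
Qed.

Lemma elasticity_gt0 r : 0 < r -> 0 < A r.
Proof. by move=> r0; have [_ _ ? ? _] := feq r0; rewrite divr_gt0 ?mulr_gt0. Qed.

Lemma slope_elasticity_gt0 r : 0 < r -> 0 < B r.
Proof.
by move=> r0; have [_ _ ? ? _] := feq r0; rewrite divr_gt0 ?mulr_gt0 ?exprn_gt0.
Qed.

Lemma slope_elasticityE r : 0 < r -> r * f2 r / f1 r = B r.
Proof.
move=> r0; have [_ _ f0 f10] := feq r0; rewrite /slope_elasticity.
case: n n_ge2 => // m _ /=; rewrite expr_div_n => e.
rewrite !exprS; move: e; set p := f1 r ^+ m; set q := r ^+ m => e.
have p0 : 0 < p by rewrite exprn_gt0.
have q0 : 0 < q by rewrite exprn_gt0.
have -> : f2 r = q / (f r * p).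
  apply: (@mulfI _ (f r * (p / q))); first by rewrite !mulf_neq0 ?invr_eq0 ?gt_eqF.
  by rewrite -[LHS]mulrA -[_ * f2 r]mulrC [LHS]mulrA e; field; rewrite !gt_eqF.
by field; rewrite !gt_eqF.
Qed.

(** As r d/dr = d/ds for s = ln r, this and the next lemma are the two equations
    of an autonomous Lotka-Volterra system in the variable s. *)
Lemma der1_elasticity r : 0 < r -> der1 A r (A r * (1 + B r - A r) / r).
Proof.
move=> r0; have [df df1 f0 f10 _] := feq r0.
rewrite -slope_elasticityE// /elasticity; apply: der1_eq.
  apply: der1M; first by apply: der1M df1; exact: der1_id.
  by apply: der1V df; rewrite gt_eqF.
by rewrite /=; field; rewrite !gt_eqF.
Qed.

Lemma der1_slope_elasticity r : 0 < r ->
  der1 B r (B r * (n%:R - A r - n%:R * B r) / r).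
Proof.
move=> r0; have [df df1 f0 f10 _] := feq r0.
rewrite -{2}slope_elasticityE// /elasticity /slope_elasticity; apply: der1_eq.
  apply: der1M; first by apply: der1X; exact: der1_id.
  apply: der1V; first by rewrite mulf_neq0 ?expf_neq0 ?gt_eqF.
  by apply: der1M; [exact: df|apply: der1X; exact: df1].
rewrite /=; case: n n_ge2 => // m _ /=; rewrite !exprS.
have p0 : 0 < f1 r ^+ m by rewrite exprn_gt0.
by field; rewrite !gt_eqF.
Qed.

Definition lyapunov r := entropy al (A r) + entropy be (B r).
Local Notation V := lyapunov.

Lemma lyapunov_ge0 r : 0 < r -> 0 <= V r.
Proof.
move=> r0; rewrite addr_ge0// entropy_ge0//.
- exact: growth_exponent_gt0.
- exact: elasticity_gt0.
- exact: slope_exponent_gt0.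
- exact: slope_elasticity_gt0.
Qed.

(** The off-diagonal terms of the Lotka-Volterra system cancel in dV/ds, since
    their coefficients are 1 and -1; this is what makes V a Lyapunov
    function. *)
Lemma der1_lyapunov r : 0 < r ->
  der1 V r (- ((A r - al) ^+ 2 + n%:R * (B r - be) ^+ 2) / r).
Proof.
move=> r0; have A0 := elasticity_gt0 r0; have B0 := slope_elasticity_gt0 r0.
rewrite /lyapunov; apply: der1_eq.
  apply: der1D.
    apply: der1_comp; first exact: der1_elasticity.
    by apply: der1_entropy A0; exact: growth_exponent_gt0.
  apply: der1_comp; first exact: der1_slope_elasticity.
  by apply: der1_entropy B0; exact: slope_exponent_gt0.
have -> : 1 + B r - A r = (B r - be) - (A r - al) by rewrite growth_exponentE; ring.
have -> : n%:R - A r - n%:R * B r = - (A r - al) - n%:R * (B r - be).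
  by rewrite -{1}exponents_sum; ring.
by field; rewrite !gt_eqF.
Qed.

Lemma lyapunov_nincr r s : 0 < r -> r <= s -> V s <= V r.
Proof.
move=> r0 rs; rewrite -lerN2.
pose D x := ((A x - al) ^+ 2 + n%:R * (B x - be) ^+ 2) / x.
have dV x : r <= x -> der1 (fun x => - V x) x (D x).
  move=> rx; apply: der1_eq.
    by apply: der1N; apply: der1_lyapunov; exact: lt_le_trans rx.
  by rewrite /D mulNr opprK.
apply: (@der1_ge0_le R (fun x => - V x) D _ _ rs).
- by apply: der1_within_continuous => x /andP[rx _]; exact: dV.
- by move=> x /andP[/ltW rx _]; exact: dV.
- move=> x /andP[rx _]; apply: divr_ge0; last exact: ltW (lt_trans r0 rx).
  by apply: addr_ge0; [exact: sqr_ge0|apply: mulr_ge0 (sqr_ge0 _)].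
Qed.

(** Along the trajectory V <= V 1 keeps A and B away from 0, so that the
    entropies are dominated by the dissipation: r V' <= - k V, and r ^ k V is
    non-increasing. *)
Lemma lyapunov_decay :
  exists2 k : R, 0 < k & forall r, 1 <= r -> V r <= V 1 * expR (- (k * ln r)).
Proof.
have al0 := growth_exponent_gt0; have be0 := slope_exponent_gt0.
have [a a0 aP] := @entropy_bounded R al (V 1) al0.
have [b b0 bP] := @entropy_bounded R be (V 1) be0.
pose k := Num.min a b.
have k0 : 0 < k by rewrite lt_min a0 b0.
have weak c x y : 0 < c -> 0 < x -> k <= x -> entropy c x <= y / x ->
    k * entropy c x <= y.
  move=> c0 x0 kx; rewrite ler_pdivlMr// mulrC; apply: le_trans.
  by rewrite ler_wpM2r// entropy_ge0.
have kdiss r : 1 <= r -> k * V r <= (A r - al) ^+ 2 + n%:R * (B r - be) ^+ 2.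
  move=> r1; have r0 : 0 < r by rewrite (lt_le_trans _ r1).
  have A0 := elasticity_gt0 r0; have B0 := slope_elasticity_gt0 r0.
  have Vr : entropy al (A r) + entropy be (B r) <= V 1 by exact: lyapunov_nincr.
  have eA0 := entropy_ge0 al0 A0; have eB0 := entropy_ge0 be0 B0.
  have kA : k <= A r by rewrite ge_min aP//; lra.
  have kB : k <= B r by rewrite ge_min (bP (B r)) ?orbT//; lra.
  rewrite /V mulrDr; apply: lerD; first by apply: weak => //; exact: entropy_le.
  apply: (@le_trans _ _ ((B r - be) ^+ 2)).
    by apply: weak => //; exact: entropy_le.
  by rewrite ler_peMl ?sqr_ge0// ler1n ltnW.
exists k => // r r1.
rewrite expRN ler_pdivlMr ?expR_gt0//.
pose W x := - (V x * expR (k * ln x)).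
pose W' x := (((A x - al) ^+ 2 + n%:R * (B x - be) ^+ 2) - k * V x)
             * expR (k * ln x) / x.
have dW x : 1 <= x -> der1 W x (W' x).
  move=> x1; have x0 : 0 < x by rewrite (lt_le_trans _ x1).
  apply: der1_eq.
    apply: der1N; apply: der1M; first exact: der1_lyapunov.
    apply: der1_expR; apply: der1M; first exact: der1_cst.
    by apply: der1_ln; [exact: x0|exact: der1_id].
  by rewrite /W'; field; rewrite gt_eqF.
have : W 1 <= W r.
  apply: (@der1_ge0_le R W W' _ _ r1) => [|x|x].
  - by apply: der1_within_continuous => x /andP[x1 _]; exact: dW.
  - by move=> /andP[/ltW x1 _]; exact: dW.
  - move=> /andP[/ltW x1 _]; apply: divr_ge0; last exact: le_trans x1.
    by apply: mulr_ge0 (expR_ge0 _); rewrite subr_ge0 kdiss.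
by rewrite /W ln1 mulr0 expR0 mulr1 lerN2.
Qed.

Lemma lyapunov_cvg0 : V r @[r --> +oo] --> 0.
Proof.
have [k k0 kP] := lyapunov_decay.
apply: (@squeeze_cvgr _ _ _ _ (fun=> 0) (fun r => V 1 * expR (- (k * ln r)))).
- near=> r; have r1 : 1 <= r by near: r; exact: nbhs_pinfty_ge.
  by rewrite kP// andbT lyapunov_ge0// (lt_le_trans _ r1).
- exact: cvg_cst.
- rewrite -[X in _ --> X](mulr0 (V 1)); apply: cvgM; first exact: cvg_cst.
  apply: cvg_comp (@cvgr_expR R).
  by apply: gt0_cvgMry => //; exact: cvg_ln_pinfty.
Unshelve. all: by end_near. Qed.

Let near_gt0 : \forall r \near +oo, 0 < r :> R.
Proof. exact: nbhs_pinfty_gt. Qed.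

Lemma elasticity_cvg : A r @[r --> +oo] --> al.
Proof.
apply: entropy_cvg; first exact: growth_exponent_gt0.
  by near=> r; apply: elasticity_gt0; near: r.
apply: (@squeeze_cvgr _ _ _ _ (fun=> 0) V) lyapunov_cvg0; last exact: cvg_cst.
near=> r; have r0 : 0 < r by near: r.
have A0 := elasticity_gt0 r0; have B0 := slope_elasticity_gt0 r0.
by rewrite entropy_ge0 ?growth_exponent_gt0//= lerDl entropy_ge0 ?slope_exponent_gt0.
Unshelve. all: by end_near. Qed.

Lemma slope_elasticity_cvg : B r @[r --> +oo] --> be.
Proof.
apply: entropy_cvg; first exact: slope_exponent_gt0.
  by near=> r; apply: slope_elasticity_gt0; near: r.
apply: (@squeeze_cvgr _ _ _ _ (fun=> 0) V) lyapunov_cvg0; last exact: cvg_cst.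
near=> r; have r0 : 0 < r by near: r.
have A0 := elasticity_gt0 r0; have B0 := slope_elasticity_gt0 r0.
by rewrite entropy_ge0 ?slope_exponent_gt0//= lerDr entropy_ge0 ?growth_exponent_gt0.
Unshelve. all: by end_near. Qed.

(** The definitions give B A ^ n = r ^ (2 n) / phi ^ (n + 1), so that the limits
    of the elasticities also determine the leading coefficient of phi. *)
Lemma profile_elasticities r : 0 < r ->
  f r / r `^ al = ((B r * A r ^+ n) `^ n.+1%:R^-1)^-1.
Proof.
move=> r0; have [_ _ f0 f10 _] := feq r0.
have -> : B r * A r ^+ n = r ^+ (2 * n) / f r ^+ n.+1.
  rewrite /elasticity /slope_elasticity expr_div_n exprMn exprS mul2n -addnn exprD.
  have p0 : 0 < f1 r ^+ n by rewrite exprn_gt0.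
  have q0 : 0 < f r ^+ n by rewrite exprn_gt0.
  by field; rewrite !gt_eqF.
rewrite powRM ?invr_ge0 ?exprn_ge0 ?ltW// -powR_invn ?ltW//.
rewrite -powR_mulrn ?ltW// -!powRrM mulNr divff ?pnatr_eq0// powR_inv1 ?ltW//.
by rewrite invfM invrK natrM mulrC.
Qed.

Lemma profile_cvg : f r / r `^ al @[r --> +oo] --> phi_asymp_const R n.
Proof.
have al0 := growth_exponent_gt0; have be0 := slope_exponent_gt0.
have c0 : 0 < be * al ^+ n by rewrite mulr_gt0 ?exprn_gt0.
have -> : phi_asymp_const R n = ((be * al ^+ n) `^ n.+1%:R^-1)^-1.
  have n0 : 0 <= n%:R - 1 :> R by rewrite subr_ge0 ler1n ltnW.
  have -> : be * al ^+ n = (2 * n%:R) ^+ n * (n%:R - 1) / n.+1%:R ^+ n.+1.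
    rewrite /growth_exponent /slope_exponent expr_div_n exprS.
    have : n.+1%:R != 0 :> R by rewrite pnatr_eq0.
    by move: (n.+1%:R) => N N0; field; rewrite N0 expf_neq0.
  rewrite powRM ?mulr_ge0 ?invr_ge0 ?exprn_ge0// powRM ?exprn_ge0 ?mulr_ge0//.
  rewrite -powR_invn// -powRrM mulNr divff ?pnatr_eq0// powR_inv1//.
  by rewrite -powR_mulrn ?mulr_ge0// -powRrM invfM invrK mulrC.
apply: (near_cvg (fun r => ((B r * A r ^+ n) `^ n.+1%:R^-1)^-1)).
  near=> r; have r0 : 0 < r by near: r.
  by rewrite profile_elasticities.
apply: cvgV; first by rewrite gt_eqF ?powR_gt0.
apply: cvg_powR => //; apply: cvgM; first exact: slope_elasticity_cvg.
have cX := @exprn_continuous R n al.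
exact: cvg_comp elasticity_cvg cX.
Unshelve. all: by end_near. Qed.

Lemma profile_der_cvg :
  f1 r / (al * r `^ be) @[r --> +oo] --> phi_asymp_const R n.
Proof.
have al0 := growth_exponent_gt0.
have lim : A r / al * (f r / r `^ al) @[r --> +oo] --> al / al * phi_asymp_const R n.
  apply: cvgM; last exact: profile_cvg.
  by apply: cvgM; [exact: elasticity_cvg|exact: cvg_cst].
rewrite divff ?gt_eqF// mul1r in lim; apply: (near_cvg _ _ lim).
near=> r; have r0 : 0 < r by near: r.
have [_ _ f0 f10 _] := feq r0.
rewrite /= growth_exponentE powRD ?(gt_eqF r0) ?implybT// powRr1 ?ltW// /elasticity.
have p0 : 0 < r `^ be by rewrite powR_gt0.
by field; rewrite -growth_exponentE !gt_eqF.
Unshelve. all: by end_near. Qed.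

Lemma profile_der2_cvg :
  f2 r / (al * be * r `^ (be - 1)) @[r --> +oo] --> phi_asymp_const R n.
Proof.
have al0 := growth_exponent_gt0; have be0 := slope_exponent_gt0.
have lim : B r / be * (f1 r / (al * r `^ be)) @[r --> +oo] -->
    be / be * phi_asymp_const R n.
  apply: cvgM; last exact: profile_der_cvg.
  by apply: cvgM; [exact: slope_elasticity_cvg|exact: cvg_cst].
rewrite divff ?gt_eqF// mul1r in lim; apply: (near_cvg _ _ lim).
near=> r; have r0 : 0 < r by near: r.
have [_ _ f0 f10 _] := feq r0.
rewrite /= -slope_elasticityE// -(mulr_powRB1 (ltW r0) be0).
have p0 : 0 < r `^ (be - 1) by rewrite powR_gt0.
by field; rewrite !gt_eqF.
Unshelve. all: by end_near. Qed.

End ProfileAsymptotics.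

Lemma profile_equation_scale (R : realType) n (f f1 f2 : R -> R) K c b :
  (0 < n)%N -> 0 < c -> 0 < b -> profile_equation n f f1 f2 K ->
  profile_equation n (fun r => c * f (b * r)) (fun r => c * b * f1 (b * r))
    (fun r => c * b ^+ 2 * f2 (b * r)) (c ^+ n.+1 * b ^+ (2 * n) * K).
Proof.
move=> n0 c0 b0 feq r r0; have br0 : 0 < b * r by rewrite mulr_gt0.
have [df df1 f0 f10 eqr] := feq _ br0.
have c'0 : 0 < c * b by exact: mulr_gt0.
split; [| |exact: mulr_gt0|exact: mulr_gt0|].
- exact: der1_scale.
- by apply: der1_eq; [exact: der1_scale df1|rewrite expr2; ring].
rewrite -eqr; case: n n0 {feq eqr} => // m _.
have -> : c * b * f1 (b * r) / r = c * b ^+ 2 * (f1 (b * r) / (b * r)).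
  by field; rewrite !gt_eqF.
rewrite /= mulnS exprD exprM; move: (b ^+ 2) => q.
by rewrite !exprMn !exprS; ring.
Qed.

(** * The integral equation and its unique solution *)

Section Primitive.
Variables (R : realType) (f : R -> R).
Hypothesis cf : {within `[0, +oo[, continuous f}.

Local Notation G r := (\int[@lebesgue_measure R]_(s in `[0, r]) f s).

Let integrable_f M : (@lebesgue_measure R).-integrable `[0, M] (EFin \o f).
Proof.
apply: continuous_compact_integrable; first exact: segment_compact.
by apply: continuous_subspaceW cf; exact: subset_itvl.
Qed.

Lemma Rintegral0 : G 0 = 0.
Proof. by rewrite set_itv1 Rintegral_set1. Qed.

Lemma Rintegral_continuous M : 0 <= M ->
  {within `[0, M], continuous (fun r => G r)}.
Proof. by move=> M0; exact: parameterized_integral_continuous. Qed.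

Lemma der1_Rintegral r : 0 < r -> der1 (fun r => G r) r (f r).
Proof.
move=> r0; have r1 : r < r + 1 by rewrite ltrDl.
have cfr : {for r, continuous f}.
  have := @continuous_subspaceW R R `]0, +oo[%classic `[0, +oo[%classic f _ cf.
  rewrite continuous_open_subspace//; apply; last by rewrite inE/= in_itv/= r0.
  by apply: subset_itvr; rewrite bnd_simp.
have [dG <-] := continuous_FTC1_closed r1 (integrable_f _) r0 cfr.
exact: derivable_der1.
Qed.

End Primitive.

Section IntegralEquation.
Variables (R : realType) (n : nat).
Hypothesis n_gt0 : (0 < n)%N.
Implicit Types f g phi : R -> R.

Lemma nondecreasing_der1_ge0 f f' r : 0 < r ->
  {in `[0, +oo[ &, {homo f : x y / x <= y}} ->
  (forall x, 0 < x -> der1 f x (f' x)) -> 0 <= f' r.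
Proof.
move=> r0 f_nd df; rewrite leNgt; apply/negP => f'r.
(* adding a small linear function makes f strictly increasing *)
pose e := - f' r / 2.
have e0 : 0 < e by rewrite /e; lra.
pose g x := f x + e * x.
have dg x : 0 < x -> der1 g x (f' x + (e * 1 + x * 0)).
  move=> x0; apply: der1D; first exact: df.
  by apply: der1M; [exact: der1_cst|exact: der1_id].
suff : 0 <= derive1 g r by rewrite (der1E (dg r r0)) /e; lra.
apply: (@incr_derive1_ge0_itvy _ g true 0).
- by move=> x; rewrite inE/= in_itv/= andbT => /dg[].
- move=> x y x0 y0 xy; rewrite /g ler_ltD ?ltr_pM2l//.
  by apply: f_nd (ltW xy); rewrite inE.
- by rewrite in_itv/= r0.
Qed.

Lemma subset_segment_itvy (M : R) : `[0, M]%classic `<=` `[0, +oo[%classic.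
Proof. exact: subset_itvl. Qed.

Lemma integrand_continuous f : {within `[0, +oo[, continuous f} ->
  (forall r, 0 <= r -> 0 < f r) ->
  {within `[0, +oo[, continuous (fun s => s ^+ n.-1 / f s)}.
Proof.
move=> cf f0; apply/subspace_continuousP => x; rewrite /= in_itv/= andbT => x0.
apply: cvgM.
  by apply: cvg_within_filter; exact: exprn_continuous.
apply: cvgV; first by rewrite gt_eqF ?f0.
by move/subspace_continuousP : cf; apply; rewrite /= in_itv/= x0.
Qed.

Lemma is_phi1_ge1 f r : is_phi1 n f -> 0 <= r -> 1 <= f r.
Proof.
by case=> _ nd <- _ r0; apply: nd => //; rewrite inE/= in_itv/= ?lexx ?r0.
Qed.

(** The uniqueness proof compares derivatives; it uses the integral only through
    its derivative and its value 0 at 0. *)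
Lemma is_phi1_der f : is_phi1 n f -> exists P : R -> R,
  [/\ P 0 = 0, forall M, 0 <= M -> {within `[0, M], continuous P},
      forall r, 0 < r -> der1 P r (n%:R * (r ^+ n.-1 / f r))
    & forall r, 0 < r -> derive1 f r ^+ n = P r].
Proof.
move=> f1; have [cf nd f0 eqf] := f1.
have cg : {within `[0, +oo[, continuous (fun s => s ^+ n.-1 / f s)}.
  apply: integrand_continuous => // r r0.
  by rewrite (lt_le_trans _ (is_phi1_ge1 f1 r0)).
exists (fun r => n%:R * \int[@lebesgue_measure R]_(s in `[0, r]) (s ^+ n.-1 / f s)).
split=> [|M M0|r r0|r r0].
- by rewrite Rintegral0 mulr0.
- move=> x; apply: cvgM; first exact: cvg_cst.
  exact: Rintegral_continuous.
- apply: der1_eq; first by apply: der1M; [exact: der1_cst|exact: der1_Rintegral].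
  by rewrite mulr0 addr0.
- by have [_ ->] := eqf r r0.
Qed.

(** The profile equation says (phi' ^ n)' = n r ^ (n - 1) / phi, so phi' ^ n and n
    times the integral have the same derivative; the conditions at 0 make both
    vanish there. *)
Lemma profile_is_phi1 f f1 f2 : profile_equation n f f1 f2 1 ->
  {for 0, continuous f} -> {for 0, continuous f1} -> f 0 = 1 -> f1 0 = 0 ->
  is_phi1 n f.
Proof.
move=> feq cf0 cf10 f01 f100.
have df r : 0 < r -> der1 f r (f1 r) by move=> /feq[].
have df1 r : 0 < r -> der1 f1 r (f2 r) by move=> /feq[].
have cont (h h' : R -> R) : {for 0, continuous h} ->
    (forall r, 0 < r -> der1 h r (h' r)) ->
    {within `[0, +oo[, continuous h}.
  move=> ch dh; apply: continuous_in_subspaceT => x.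
  rewrite inE/= in_itv/= andbT le_eqVlt => /predU1P[<-//|x0].
  exact: der1_continuous (dh _ x0).
have cf := cont _ _ cf0 df; have cf1 := cont _ _ cf10 df1.
have mono x y : 0 <= x -> x <= y -> f x <= f y.
  move=> x0 xy; apply: (@der1_ge0_le _ f f1 _ _ xy).
  - apply: continuous_subspaceW cf => z/=; rewrite !in_itv/= andbT => /andP[+ _].
    exact: le_trans.
  - by move=> z /andP[xz _]; apply: df; exact: le_lt_trans xz.
  - by move=> z /andP[xz _]; have /feq[_ _ _ /ltW] := le_lt_trans x0 xz.
have f_gt0 r : 0 <= r -> 0 < f r.
  by move=> r0; rewrite (lt_le_trans ltr01)// -f01 mono.
split => //.
  by move=> x y; rewrite inE/= in_itv/= andbT => x0 _; exact: mono.
move=> r r0; split; first by have [] := df r r0.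
rewrite (der1E (df r r0)).
have cg := integrand_continuous cf f_gt0.
pose G r := \int[@lebesgue_measure R]_(s in `[0, r]) (s ^+ n.-1 / f s).
pose D r := f1 r ^+ n - n%:R * G r.
suff : `|D r - D 0| <= 0 - 0.
  rewrite subrr normr_le0 subr_eq0 => /eqP; rewrite /D [G 0]Rintegral0 f100 expr0n.
  by rewrite gtn_eqF// mulr0 subr0 => /subr0_eq.
apply: (@der1_le_norm _ D (fun=> 0) (fun=> 0) (fun=> 0) _ _ (ltW r0)).
- move=> x; apply: cvgB.
    apply: (@cvg_comp _ _ _ f1 (fun y => y ^+ n)); last exact: exprn_continuous.
    exact: continuous_subspaceW (@subset_segment_itvy r) cf1 x.
  apply: cvgM; first exact: cvg_cst.
  exact: (Rintegral_continuous cg (ltW r0)).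
- by move=> x; exact: cvg_cst.
- move=> x /andP[x0 _]; have [_ _ fx0 f1x0 eqx] := feq x x0.
  apply: der1_eq.
    apply: der1D; first by apply: der1X; exact: df1.
    by apply: der1N; apply: der1M; [exact: der1_cst|exact: der1_Rintegral].
  have xn0 : x ^+ n.-1 != 0 by rewrite expf_neq0 ?gt_eqF.
  rewrite -[x ^+ n.-1 / f x]mulr1 -eqx expr_div_n.
  by field; rewrite xn0 gt_eqF.
- by move=> x _; exact: der1_cst.
- by move=> x _; rewrite normr0.
Qed.

(** In p ^ n - q ^ n = (p - q) (p ^ (n - 1) + ... + q ^ (n - 1)) the first term of
    the sum is at least c ^ (n - 1). *)
Lemma expr_distance (c p q : R) : 0 <= c -> c <= p -> c <= q ->
  `|p - q| * c ^+ n.-1 <= `|p ^+ n - q ^+ n|.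
Proof.
move=> c0 cp cq; have p0 := le_trans c0 cp; have q0 := le_trans c0 cq.
rewrite subrXX normrM ler_wpM2l// ger0_norm; last first.
  by apply: sumr_ge0 => i _; rewrite mulr_ge0 ?exprn_ge0.
case: n n_gt0 => // m _; rewrite big_ord_recl/= expr0 mulr1 subn0; apply: ler_wpDr.
  by apply: sumr_ge0 => i _; rewrite mulr_ge0 ?exprn_ge0.
by rewrite lerXn2r ?nnegrE.
Qed.

(** Where phi <= K, phi' ^ n is at least the integral of n s ^ (n - 1) / K, which is
    r ^ n / K >= (r / K) ^ n. *)
Lemma is_phi1_slope f K r : is_phi1 n f -> 0 < r -> f r <= K -> r / K <= derive1 f r.
Proof.
move=> f1 r0 frK; have [cf nd f0 eqf] := f1.
have K1 : 1 <= K := le_trans (is_phi1_ge1 f1 (ltW r0)) frK.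
have K0 : 0 < K := lt_le_trans ltr01 K1.
have [P [P0 cP dP PE]] := is_phi1_der f1.
have f'0 : 0 <= derive1 f r.
  apply: (nondecreasing_der1_ge0 r0 nd) => x x0; apply: derivable_der1.
  by have [] := eqf x x0.
have rK0 : 0 <= r / K by rewrite divr_ge0// ltW.
rewrite -(@ler_pXn2r _ n)// ?nnegrE// PE//.
suff : r ^+ n / K ^+ n - 0 ^+ n / K ^+ n <= P r - P 0.
  by rewrite P0 expr0n gtn_eqF//= mul0r !subr0 expr_div_n.
pose h x := x ^+ n / K ^+ n.
have dh x : der1 h x (n%:R * x ^+ n.-1 / K ^+ n).
  apply: der1_eq.
    by apply: der1M; [apply: der1X; exact: der1_id|exact: der1_cst].
  by rewrite /= mulr0 add0r mulr1 mulrC.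
apply: (@der1_le _ h P (fun x => n%:R * x ^+ n.-1 / K ^+ n)
                       (fun x => n%:R * (x ^+ n.-1 / f x)) _ _ (ltW r0)).
- by apply: der1_within_continuous => x _; exact: dh.
- exact: cP (ltW r0).
- by move=> x _; exact: dh.
- by move=> x /andP[x0 _]; exact: dP.
- move=> x /andP[x0 xr]; rewrite -mulrA ler_wpM2l// ler_wpM2l ?exprn_ge0 ?(ltW x0)//.
  have fx1 := is_phi1_ge1 f1 (ltW x0).
  rewrite lef_pV2 ?posrE ?exprn_gt0 ?(lt_le_trans ltr01 fx1)//.
  apply: (@le_trans _ _ K); last by rewrite -[leLHS]expr1 ler_weXn2l.
  by apply: le_trans frK; apply: nd (ltW xr); rewrite inE/= in_itv/= ltW.
Qed.

(** The difference d of two solutions satisfies |d'| <= L sup_[0, r] |d| on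
    [0, M]; a bound |d| <= B e ^ (2 L r) thus improves to one with B / 2, so the
    best such B is 0. *)
Lemma is_phi1_unique f g : is_phi1 n f -> is_phi1 n g ->
  {in `[0, +oo[, f =1 g}.
Proof.
move=> f1 g1 M; rewrite inE/= in_itv/= andbT le_eqVlt => /predU1P[<-|M0].
  by have [_ _ -> _] := f1; have [_ _ -> _] := g1.
have [cf ndf f0 eqf] := f1; have [cg ndg g0 eqg] := g1.
have [P [P0 cP dP PE]] := is_phi1_der f1.
have [Q [Q0 cQ dQ QE]] := is_phi1_der g1.
pose K := Num.max (f M) (g M).
have K1 : 1 <= K by rewrite le_max (is_phi1_ge1 f1)// ltW.
have K0 : 0 < K := lt_le_trans ltr01 K1.
pose L := M * K ^+ n.-1.
have L0 : 0 < L by rewrite mulr_gt0 ?exprn_gt0.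
pose E x := expR (2 * L * x).
have E0 x : 0 < E x := expR_gt0 _.
have E0w x : 0 <= E x := expR_ge0 _.
have dE c x : der1 (fun x => c * E x) x (c * E x * (2 * L)).
  apply: der1_eq.
    apply: der1M; first exact: der1_cst.
    by apply: der1_expR; apply: der1M; [exact: der1_cst|exact: der1_id].
  by rewrite /= !mulr0 !addr0 mulr1 mulrA.
have cE c (a b : R) : {within `[a, b], continuous (fun x => c * E x)}.
  by apply: der1_within_continuous => x _; exact: dE.
have cfM : {within `[0, M], continuous f}.
  exact: continuous_subspaceW (@subset_segment_itvy M) cf.
have cgM : {within `[0, M], continuous g}.
  exact: continuous_subspaceW (@subset_segment_itvy M) cg.
pose d x := f x - g x.
have cd : {within `[0, M], continuous d}.
  by move=> x; apply: cvgB; [exact: cfM|exact: cgM].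
have sub r : r <= M -> `[0, r]%classic `<=` `[0, M]%classic.
  by move=> rM; apply: subset_itvl; rewrite bnd_simp.
have improve B : 0 <= B -> (forall x, 0 <= x <= M -> `|d x| <= B * E x) ->
    forall x, 0 <= x <= M -> `|d x| <= B / 2 * E x.
  move=> B0 dB.
  have PQ x : 0 < x <= M -> `|P x - Q x| <= x ^+ n * (B * E x).
    move=> /andP[x0 xM].
    suff : `|(P x - Q x) - (P 0 - Q 0)| <= x ^+ n * (B * E x) - 0 ^+ n * (B * E 0).
      by rewrite P0 Q0 expr0n gtn_eqF//= mul0r !subr0.
    pose h' y := n%:R * y ^+ n.-1 * (B * E y) + y ^+ n * (B * E y * (2 * L)).
    have dh y : der1 (fun y => y ^+ n * (B * E y)) y (h' y).
      apply: der1_eq.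
        by apply: der1M; [apply: der1X; exact: der1_id|exact: dE].
      by rewrite /h' /= mulr1; ring.
    apply: (@der1_le_norm _ (fun y => P y - Q y) (fun y => y ^+ n * (B * E y))
      (fun y => n%:R * (y ^+ n.-1 / f y) - n%:R * (y ^+ n.-1 / g y)) h' _ _ (ltW x0)).
    - by move=> y; apply: cvgB; [exact: cP (ltW x0) y|exact: cQ (ltW x0) y].
    - by apply: der1_within_continuous => y _; exact: dh.
    - by move=> y /andP[y0 _]; apply: der1D; [exact: dP|apply: der1N; exact: dQ].
    - by move=> y _; exact: dh.
    - move=> y /andP[y0 yx].
      have fy1 := is_phi1_ge1 f1 (ltW y0); have gy1 := is_phi1_ge1 g1 (ltW y0).
      have fy0 : 0 < f y := lt_le_trans ltr01 fy1.
      have gy0 : 0 < g y := lt_le_trans ltr01 gy1.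
      have -> : n%:R * (y ^+ n.-1 / f y) - n%:R * (y ^+ n.-1 / g y) =
          n%:R * y ^+ n.-1 * (- d y / (f y * g y)).
        by rewrite /d; field; rewrite !gt_eqF.
      have ny0 : 0 <= n%:R * y ^+ n.-1 by rewrite mulr_ge0 ?exprn_ge0 ?(ltW y0).
      rewrite normrM (ger0_norm ny0) normrM normrN normfV.
      rewrite (gtr0_norm (mulr_gt0 fy0 gy0)).
      apply: ler_wpDr.
        apply: mulr_ge0; first by rewrite exprn_ge0 ?(ltW y0).
        by apply: mulr_ge0; apply: mulr_ge0; rewrite ?E0w ?(ltW L0).
      rewrite ler_wpM2l//; apply: (@le_trans _ _ `|d y|).
        by rewrite ler_pdivrMr ?mulr_gt0// ler_peMr// mulr_ege1.
      by apply: dB; rewrite ltW//= (le_trans (ltW yx)).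
  move=> x /andP[x0 xM].
  suff dx : `|d x - d 0| <= B / 2 * E x - B / 2 * E 0.
    move: dx; rewrite /d f0 g0 subrr subr0 => /le_trans; apply.
    by rewrite gerBl mulr_ge0 ?E0w// divr_ge0.
  apply: (@der1_le_norm _ d _ (fun y => derive1 f y - derive1 g y) _ _ _ x0 _
            (cE _ _ _) _ (fun y _ => dE _ y)).
  - exact: continuous_subspaceW (sub _ xM) cd.
  - move=> y /andP[y0 _]; have [df _] := eqf y y0; have [dg _] := eqg y y0.
    by apply: der1D; [|apply: der1N]; exact: derivable_der1.
  - move=> y /andP[y0 yx]; have yM : y <= M := le_trans (ltW yx) xM.
    have ME : M \in `[0, +oo[%classic by rewrite inE/= in_itv/= ltW.
    have yE : y \in `[0, +oo[%classic by rewrite inE/= in_itv/= ltW.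
    have fyK : y / K <= derive1 f y.
      by apply: is_phi1_slope => //; rewrite le_max (ndf y M).
    have gyK : y / K <= derive1 g y.
      by apply: is_phi1_slope => //; rewrite le_max (ndg y M) ?orbT.
    have yK0 : 0 < y / K by rewrite divr_gt0.
    have := expr_distance (ltW yK0) fyK gyK; rewrite PE// QE//.
    move=> /le_trans /(_ (PQ y _)); rewrite y0 yM => /(_ isT).
    rewrite -ler_pdivlMr ?exprn_gt0// => /le_trans; apply.
    have -> : y ^+ n * (B * E y) / (y / K) ^+ n.-1 = y * K ^+ n.-1 * (B * E y).
      case: n n_gt0 => // m _; rewrite exprS expr_div_n/=.
      by field; rewrite !expf_neq0 ?gt_eqF.
    have -> : B / 2 * E y * (2 * L) = L * (B * E y) by field.
    by rewrite ler_wpM2r ?mulr_ge0 ?E0w// ler_wpM2r ?exprn_ge0 ?(ltW K0).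
have cdE : {within `[0, M], continuous (fun x => `|d x| * (1 * E x)^-1)}.
  move=> x; apply: cvgM; first by apply: cvg_norm; exact: cd.
  by apply: cvgV; [rewrite mul1r gt_eqF ?E0|exact: cE].
have [c c0M cmax] := EVT_max (ltW M0) cdE.
pose B := `|d c| / (1 * E c).
have B0 : 0 <= B by rewrite divr_ge0// mul1r E0w.
have dB x : 0 <= x <= M -> `|d x| <= B * E x.
  move=> x0M; rewrite -[E x]mul1r -ler_pdivrMr ?mul1r ?E0//.
  by have := cmax x; rewrite in_itv/= => /(_ x0M); rewrite /B !mul1r.
have BB : B <= B / 2.
  rewrite {1}/B ler_pdivrMr mul1r ?E0//; apply: (improve _ B0 dB).
  by move: c0M; rewrite in_itv/=.
have B00 : B = 0 by lra.
have := dB M; rewrite lexx (ltW M0) B00 mul0r normr_le0 => /(_ isT).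
by rewrite subr_eq0 => /eqP.
Qed.

End IntegralEquation.

(** * Hessians of radial functions *)

Section Lines.
Variables (R : realType) (V : normedModType R).
Implicit Types (f : V -> R) (v p : V).

Let quotient_line f v p (r : R) :
  (fun h : R => h^-1 *: (((fun s => f (s *: v + p)) \o shift r) (h *: (1 : R))
                         - f (r *: v + p)))
  = (fun h : R => h^-1 *: ((f \o shift (r *: v + p)) (h *: v) - f (r *: v + p))).
Proof.
apply/funext => h /=; congr (_ *: (f _ - _)).
by rewrite /shift/= addrA -scalerDl [h *: 1]mulr1.
Qed.

Lemma der1_line f v p r : derivable f (r *: v + p) v ->
  der1 (fun s => f (s *: v + p)) r ('D_v f (r *: v + p)).
Proof.
by rewrite /derivable -quotient_line => df; split; rewrite // /derive quotient_line.
Qed.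

Lemma derive_line f v p a :
  der1 (fun s => f (s *: v + p)) 0 a -> 'D_v f p = a.
Proof.
move=> [_ <-]; rewrite /derive.
have p0 : 0 *: v + p = p by rewrite scale0r add0r.
by have := quotient_line f v p 0; rewrite p0 => <-.
Qed.

End Lines.

Section Radial.
Variables (R : realType) (n : nat).
Implicit Types (x y : 'rV[R]_n) (i j : 'I_n).

Lemma sqr_enorm x : enorm x ^+ 2 = \sum_(i < n) x 0 i ^+ 2.
Proof. by rewrite sqr_sqrtr// sumr_ge0// => i _; rewrite sqr_ge0. Qed.

Lemma enorm_ge0 x : 0 <= enorm x.
Proof. exact: sqrtr_ge0. Qed.

Lemma enormZ c x : enorm (c *: x) = `|c| * enorm x.
Proof.
rewrite /enorm -sqrtr_sqr -sqrtrM ?sqr_ge0// mulr_sumr.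
by congr Num.sqrt; apply: eq_bigr => i _; rewrite !mxE exprMn.
Qed.

Lemma enorm_delta i : enorm (delta_mx 0 i : 'rV[R]_n) = 1.
Proof.
rewrite /enorm (bigD1 i)//= big1 => [|j ji]; last first.
  by rewrite mxE (negbTE ji) andbF expr0n.
by rewrite mxE !eqxx expr1n addr0 sqrtr1.
Qed.

Lemma enorm_line i x s :
  enorm (s *: delta_mx 0 i + x) = Num.sqrt (enorm x ^+ 2 + (2 * x 0 i * s + s ^+ 2)).
Proof.
rewrite sqr_enorm /enorm (bigD1 i)//= [in RHS](bigD1 i)//=.
rewrite !mxE !eqxx mulr1 addrAC; congr Num.sqrt; congr (_ + _); first by ring.
by apply: eq_bigr => j ji; rewrite !mxE (negbTE ji) andbF mulr0 add0r.
Qed.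

Lemma der1_enorm_line i x : 0 < enorm x ->
  der1 (fun s => enorm (s *: delta_mx 0 i + x)) 0 (x 0 i / enorm x).
Proof.
move=> x0; under eq_fun do rewrite enorm_line.
pose q s := enorm x ^+ 2 + (2 * x 0 i * s + s ^+ 2).
have q0 : q 0 = enorm x ^+ 2 by rewrite /q mulr0 expr0n !addr0.
have sq0 : 0 < q 0 by rewrite q0 exprn_gt0.
apply: der1_eq.
  apply: (@der1_comp _ _ q); last exact: is_derive1_sqrt sq0.
  apply: der1D; first exact: der1_cst.
  apply: der1D; last by apply: der1X; exact: der1_id.
  by apply: der1M; [exact: der1_cst|exact: der1_id].
by rewrite q0 sqrtr_sqr gtr0_norm//=; field; rewrite gt_eqF.
Qed.

Variables (f f1 f2 : R -> R) (c : R).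
Hypothesis df : forall r, 0 < r -> der1 f r (f1 r).
Hypothesis df1 : forall r, 0 < r -> der1 f1 r (f2 r).

Local Notation F := (fun y : 'rV[R]_n => c * f (enorm y)).

Lemma derive_radial j y : 0 < enorm y ->
  'D_(delta_mx 0 j) F y = c * (f1 (enorm y) * (y 0 j / enorm y)).
Proof.
move=> y0; apply: derive_line; apply: der1_eq.
  apply: der1M; first exact: der1_cst.
  apply: der1_comp; first exact: der1_enorm_line.
  by rewrite scale0r add0r; exact: df.
by rewrite mulr0 addr0.
Qed.

Lemma derive2_radial i0 i j r : 0 < r ->
  'D_(delta_mx 0 i) ('D_(delta_mx 0 j) F) (r *: delta_mx 0 i0) =
  c * (if i == j then if i == i0 then f2 r else f1 r / r else 0).
Proof.
move=> r0; set p := r *: delta_mx 0 i0.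
have ep : enorm p = r by rewrite enormZ enorm_delta mulr1 gtr0_norm.
have ep0 : 0 < enorm p by rewrite ep.
have de := der1_enorm_line i ep0.
apply: derive_line.
pose rho s := enorm (s *: delta_mx 0 i + p).
have rho0 : rho 0 = r by rewrite /rho scale0r add0r.
pose H s := c * (f1 (rho s) * ((s * (j == i)%:R + p 0 j) / rho s)).
apply: (@near_der1 _ H).
  have : \forall s \near (0 : R), 0 < rho s.
    have crho : rho s @[s --> 0] --> r by rewrite -rho0; exact: der1_continuous de.
    exact: (cvgr_gt _ crho).
  apply: filterS => s s0; rewrite derive_radial// /H.
  by rewrite !mxE eqxx eq_sym.
have dr : der1 (fun s => f1 (rho s)) 0 (f2 r * (p 0 i / r)).
  by rewrite -{2}ep; apply: der1_comp; [exact: de|rewrite -/(rho 0) rho0; exact: df1].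
have dn : der1 (fun s => s * (j == i)%:R + p 0 j) 0 ((j == i)%:R).
  apply: der1_eq.
    apply: der1D; last exact: der1_cst.
    by apply: der1M; [exact: der1_id|exact: der1_cst].
  by rewrite mulr0 add0r mulr1 addr0.
apply: der1_eq.
  apply: der1M; first exact: der1_cst.
  apply: der1M; first exact: dr.
  apply: der1M; first exact: dn.
  apply: (@der1V _ rho); last exact: de.
  by rewrite rho0 gt_eqF.
rewrite /= rho0 ep mulr0 addr0 /p !mxE !eqxx /=; congr (_ * _).
have r00 : r != 0 by rewrite gt_eqF.
have [<-|ij] := eqVneq i j.
  by case: (eqVneq i i0) => _ /=; field.
have [ei|_] := eqVneq i i0; last by rewrite /=; field.
by rewrite -ei eq_sym (negbTE ij) /=; field.
Qed.

(** At a point of a coordinate axis the Hessian is diagonal: phi'' in the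
    radial direction, phi' / r in the others. *)
Lemma det_hessian_radial i0 r : 0 < r ->
  \det (\matrix_(i, j)
    'D_(delta_mx 0 i) ('D_(delta_mx 0 j) F) (r *: delta_mx 0 i0)) =
  c ^+ n * (f2 r * (f1 r / r) ^+ n.-1).
Proof.
move=> r0.
rewrite (_ : \matrix_(i, j) _ =
    diag_mx (\row_i (c * (if i == i0 then f2 r else f1 r / r)))).
  rewrite det_diag (bigD1 i0)//= mxE eqxx.
  rewrite (eq_bigr (fun=> c * (f1 r / r))) => [|i ii0]; last first.
    by rewrite mxE (negbTE ii0).
  have -> : \prod_(i < n | i != i0) (c * (f1 r / r)) = (c * (f1 r / r)) ^+ n.-1.
    by rewrite prodr_const cardC1 card_ord.
  rewrite exprMn; case: n i0 => [[]//|m _]/=; rewrite exprS; ring.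
apply/matrixP => i j; rewrite !mxE derive2_radial//.
by case: eqP; rewrite ?mulr1n ?mulr0n ?mulr0.
Qed.

End Radial.

(** * Separated solutions *)

Lemma nonvanishing_same_sign (R : realType) (h : R -> R) a b : a <= b ->
  {within `[a, b], continuous h} -> (forall x, a <= x <= b -> h x != 0) ->
  (0 < h a) = (0 < h b).
Proof.
move=> ab ch h0; apply/idP/idP => hpos; rewrite ltNge; apply/negP => hneg.
- have [|c] := @IVT _ h a b 0 ab ch.
    by rewrite ge_min hneg orbT le_max ltW.
  by rewrite in_itv/= => /h0 /eqP.
- have [|c] := @IVT _ h a b 0 ab ch.
    by rewrite ge_min hneg le_max (ltW hpos) orbT.
  by rewrite in_itv/= => /h0 /eqP.
Qed.

Section Separated.
Variables (R : realType) (n : nat) (u : 'rV[R]_n * R -> R) (w phi : R -> R).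
Hypotheses (n_ge2 : (2 <= n)%N)
  (u_smooth : smooth_on [set p : 'rV[R]_n * R | p.2 < 0] u)
  (u_pconvex : parabolically_convex u)
  (u_solution : parabolic_MA_solution u)
  (u_separated : forall (x : 'rV[R]_n) (t : R), t <= 0 ->
     u (x, t) = w t * phi (enorm x)).

Let i0 : 'I_n := Ordinal (ltnW n_ge2).
Let e : 'rV[R]_n := delta_mx 0 i0.

Let enorm_axis r : enorm (r *: e) = `|r|.
Proof. by rewrite enormZ enorm_delta mulr1. Qed.

Let enorm0 : enorm (0 : 'rV[R]_n) = 0.
Proof. by rewrite -(scale0r e) enorm_axis normr0. Qed.

Let near_neg (t : R) : t < 0 -> \forall s \near t, s <= 0.
Proof. by move=> t0; apply: (filterS _ (lt_nbhsl t0)) => s /ltW. Qed.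

Lemma separated_w_neq0 t : t < 0 -> w t != 0.
Proof.
move=> t0; apply/eqP => wt; have := u_solution 0 t0.
have -> : hessian u 0 t = 0.
  apply/matrixP => i j; rewrite !mxE.
  have -> : (fun y => u (y, t)) = cst 0.
    by apply/funext => y; rewrite u_separated ?ltW// wt mul0r.
  have -> : 'D_(delta_mx 0 j) (cst (0 : R)) = cst 0 :> ('rV[R]_n -> R).
    by apply/funext => y; rewrite derive_cst.
  by rewrite derive_cst.
have det_0 k : (0 < k)%N -> \det (0 : 'M[R]_k) = 0 by case: k => // m _; exact: det0.
rewrite det_0 ?mulr0; last exact: ltnW.
move=> /eqP.
by rewrite eq_sym oner_eq0.
Qed.

Lemma separated_phi_neq0 r : 0 <= r -> phi r != 0.
Proof.
move=> r0; apply/eqP => phir; have N10 : -1 < 0 :> R by rewrite ltrN10.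
have := u_solution (r *: e) N10.
have -> : dt u (r *: e) (-1) = 0.
  apply: der1E; apply: (@near_der1 _ (fun=> 0)); last exact: der1_cst.
  apply: filterS (near_neg N10) => s s0.
  by rewrite u_separated// enorm_axis ger0_norm// phir mulr0.
by rewrite oppr0 mul0r => /eqP; rewrite eq_sym oner_eq0.
Qed.

Lemma der1_separated_w t : t < 0 -> der1 w t (derive1 w t).
Proof.
move=> t0; apply: derivable_der1.
have phi0 := separated_phi_neq0 (lexx 0).
pose v : 'rV[R]_n * R := (0, 1).
have [_ /(_ v) [du _]] := u_smooth 1.
have vE s : s *: v + 0 = (0, s).
  by rewrite addr0; congr pair; rewrite /= ?scaler0// [LHS]mulr1.
have dline : der1 (fun s => u (s *: v + 0) / phi 0) t
    (u (t *: v + 0) * 0 + (phi 0)^-1 * 'D_v u (t *: v + 0)).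
  apply: der1M; last exact: der1_cst.
  by apply: der1_line; apply: du; rewrite vE.
suff : der1 w t (u (t *: v + 0) * 0 + (phi 0)^-1 * 'D_v u (t *: v + 0)) by case.
apply: near_der1 dline; apply: filterS (near_neg t0) => s s0.
by rewrite vE u_separated// enorm0 mulfK.
Qed.

Lemma dt_separated x t : t < 0 -> dt u x t = derive1 w t * phi (enorm x).
Proof.
move=> t0; apply: der1E.
have dw : der1 (fun s => w s * phi (enorm x)) t
    (w t * 0 + phi (enorm x) * derive1 w t).
  by apply: der1M (der1_cst _ _); exact: der1_separated_w.
rewrite mulr0 add0r mulrC in dw; apply: near_der1 dw.
by apply: filterS (near_neg t0) => s s0; rewrite u_separated.
Qed.

(** The extension of phi to an even function: up to a factor it is the restriction
    of u to a line, hence smooth also at 0. *)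
Definition even_profile r := u (r *: e, -1) / w (-1).
Local Notation f := even_profile.
Local Notation f1 := (derive1 f).
Local Notation f2 := (derive1 f1).

Let wN1 : w (-1) != 0.
Proof. by apply: separated_w_neq0; rewrite ltrN10. Qed.

Lemma even_profileE r : f r = phi `|r|.
Proof.
by rewrite /even_profile u_separated ?lerN10// enorm_axis mulrC mulKf.
Qed.

Lemma der1_even_profile r : der1 f r (f1 r) /\ der1 f1 r (f2 r).
Proof.
pose v : 'rV[R]_n * R := (e, 0); pose p : 'rV[R]_n * R := (0, -1).
have vE s : s *: v + p = (s *: e, -1).
  by congr pair; rewrite /= ?addr0// scaler0 add0r.
have [_ /(_ v) [du [_ /(_ v) [ddu _]]]] := u_smooth 2.
have dline (h : 'rV[R]_n * R -> R) (s : R) :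
    (forall q, q.2 < 0 -> derivable h q v) ->
    der1 (fun s => h (s *: v + p) / w (-1)) s ('D_v h (s *: v + p) / w (-1)).
  move=> dh; apply: der1_eq.
    apply: der1M; last exact: der1_cst.
    by apply: der1_line; apply: dh; rewrite vE/= ltrN10.
  by rewrite mulr0 add0r mulrC.
have fE : f = fun s => u (s *: v + p) / w (-1).
  by apply/funext => s; rewrite vE.
have df s : der1 f s ('D_v u (s *: v + p) / w (-1)).
  by rewrite fE; exact: (dline u s du).
have f1E : f1 = fun s => 'D_v u (s *: v + p) / w (-1).
  by apply/funext => s; exact: der1E.
split; first by rewrite (der1E (df r)).
have df1 : der1 f1 r ('D_v ('D_v u) (r *: v + p) / w (-1)).
  by rewrite [in der1 _]f1E; exact: (dline _ r ddu).
by rewrite (der1E df1).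
Qed.

Lemma even_profile_der0 : f1 0 = 0.
Proof.
have [df _] := der1_even_profile 0.
have dN : der1 (fun r => f (- r)) 0 (f1 0 * - 1).
  apply: der1_comp; first by apply: der1N; exact: der1_id.
  by rewrite oppr0.
have fN : (fun r => f (- r)) = f.
  by apply/funext => r; rewrite !even_profileE normrN.
by rewrite fN in dN; have := der1E dN; lra.
Qed.

Lemma separated_equation t r : t < 0 -> 0 < r ->
  - derive1 w t * w t ^+ n * (f r * f2 r * (f1 r / r) ^+ n.-1) = 1.
Proof.
move=> t0 r0; have := u_solution (r *: e) t0.
rewrite dt_separated// enorm_axis gtr0_norm//.
have uE : (fun y => u (y, t)) = (fun y => w t * f (enorm y)).
  apply/funext => y; rewrite u_separated ?ltW// even_profileE.
  by rewrite (ger0_norm (enorm_ge0 y)).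
rewrite /hessian uE.
have df s : 0 < s -> der1 f s (f1 s) by case: (der1_even_profile s).
have df1 s : 0 < s -> der1 f1 s (f2 s) by case: (der1_even_profile s).
rewrite (det_hessian_radial (w t) df df1 i0 r0).
by rewrite even_profileE gtr0_norm// => <-; ring.
Qed.

Section PositiveTimeFactor.
Hypothesis w_pos : 0 < w (-1).

Lemma even_profile_nondecreasing : {in `[0, +oo[ &, {homo f : r s / r <= s}}.
Proof.
move=> r s; rewrite !inE/= !in_itv/= !andbT => r0 s0 rs.
rewrite ler_pM2r ?invr_gt0//.
move: s0; rewrite le_eqVlt => /predU1P[s0|s0].
  by have -> : r = s by apply/eqP; rewrite eq_le rs -s0.
(* r e is the convex combination of s e and - s e with weight (1 + r / s) / 2,
   and u takes the same value at both *)
pose l := (1 + r / s) / 2.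
have rs1 : 0 <= r / s <= 1 by rewrite divr_ge0 ?(ltW s0)//= ler_pdivrMr// mul1r.
have l0 : 0 <= l by rewrite /l; lra.
have l1 : l <= 1 by rewrite /l; lra.
have [_ /(_ (-1)) cvx _] := u_pconvex.
have := cvx (lerN10 _) (Itv01 l0 l1) (s *: e) (- s *: e).
have uNs : u (- s *: e, -1) = u (s *: e, -1).
  by rewrite !u_separated ?lerN10// !enorm_axis normrN.
rewrite !inE uNs convmm => /(_ I I) /= cvx_rs.
suff -> : r *: e = l *: (s *: e) + (1 - l) *: (- s *: e) by exact: cvx_rs.
rewrite !scalerA -scalerDl; congr (_ *: _).
by rewrite /l; field; rewrite gt_eqF.
Qed.

Lemma even_profile_der_ge0 r : 0 < r -> 0 <= f1 r.
Proof.
move=> r0; apply: (nondecreasing_der1_ge0 r0 even_profile_nondecreasing).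
by move=> s _; case: (der1_even_profile s).
Qed.

Let f_cont a b : {within `[a, b], continuous f}.
Proof.
exact: der1_within_continuous (fun r _ => (der1_even_profile r).1).
Qed.

Let f1_cont a b : {within `[a, b], continuous f1}.
Proof.
exact: der1_within_continuous (fun r _ => (der1_even_profile r).2).
Qed.

(** In the separated equation the factor depending on t and the one depending on
    r are inverse constants.  By convexity f is non-decreasing, so f' > 0 for
    r > 0, and since f' 0 = 0, f'' is positive somewhere.  If f > 0 this makes the
    constant positive.  If f < 0, the constant is negative, f'' > 0 everywhere, and
    f, convex and increasing, reaches 0, which is excluded. *)
Lemma separation_constant : exists C : R, [/\ 0 < C,
  forall t, t < 0 -> - derive1 w t * w t ^+ n = C,
  0 < f 0 & profile_equation n f f1 f2 C^-1].
Proof.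
pose b r := f r * f2 r * (f1 r / r) ^+ n.-1.
pose C := (b 1)^-1.
have ab t r : t < 0 -> 0 < r -> - derive1 w t * w t ^+ n * b r = 1.
  exact: separated_equation.
have b_neq0 r : 0 < r -> b r != 0.
  move=> r0; apply/eqP => br; have := ab (-1) r.
  by rewrite ltrN10 br mulr0 => /(_ isT r0) /eqP; rewrite eq_sym oner_eq0.
have aC t : t < 0 -> - derive1 w t * w t ^+ n = C.
  by move=> t0; apply: (mulIf (b_neq0 1 ltr01)); rewrite ab// mulVf// b_neq0.
have bC r : 0 < r -> b r = C^-1.
  move=> r0; have N10 : -1 < 0 :> R by rewrite ltrN10.
  have := ab _ _ N10 r0; rewrite (aC _ N10) => Cb.
  have C0 : C != 0 by rewrite invr_eq0 b_neq0.
  by apply: (mulfI C0); rewrite Cb divff.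
have f1_gt0 r : 0 < r -> 0 < f1 r.
  move=> r0; rewrite lt_neqAle even_profile_der_ge0// andbT eq_sym.
  apply/eqP => f1r; have := b_neq0 r r0; rewrite /b f1r mul0r expr0n.
  by case: n n_ge2 => [//|[//|m _]] /=; rewrite mulr0 eqxx.
have p0 r : 0 < r -> 0 < (f1 r / r) ^+ n.-1.
  by move=> r0; rewrite exprn_gt0// divr_gt0// f1_gt0.
have f_neq0 r : 0 <= r -> f r != 0.
  by move=> r0; rewrite even_profileE separated_phi_neq0.
have fsign r : 0 <= r -> (0 < f 0) = (0 < f r).
  move=> r0; apply: (nonvanishing_same_sign r0 (@f_cont 0 r)).
  by move=> s /andP[s0 _]; exact: f_neq0.
(* the derivative grows from its value 0 at 0 *)
have [c /andP[c0 c1] f2c] : exists2 c, 0 < c < 1 & 0 < f2 c.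
  have [c] := @MVT _ f1 f2 0 1 ltr01 (fun x _ => (der1_even_profile x).2)
    (@f1_cont _ _).
  rewrite in_itv/= => c01; rewrite even_profile_der0 !subr0 mulr1 => f1f2.
  by exists c => //; rewrite -f1f2 f1_gt0.
have f0 : 0 < f 0.
  rewrite lt_neqAle eq_sym f_neq0//= leNgt; apply/negP => f0neg.
  have f_neg r : 0 <= r -> f r < 0.
    by move=> r0; rewrite lt_neqAle f_neq0// leNgt -fsign// -leNgt ltW.
  have Cneg : C^-1 < 0.
    rewrite -(bC c c0) /b (pmulr_llt0 _ (p0 c c0)).
    by rewrite (nmulr_rlt0 _ (f_neg c (ltW c0))).
  have f2_gt0 r : 0 < r -> 0 < f2 r.
    move=> r0; have : f r * f2 r * (f1 r / r) ^+ n.-1 < 0 by rewrite -/(b r) (bC r r0).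
    by rewrite (pmulr_llt0 _ (p0 r r0)) (nmulr_rlt0 _ (f_neg r (ltW r0))).
  (* the zero of the tangent line at 1 *)
  pose r := 1 - f 1 / f1 1.
  have f11 : 0 < f1 1 by exact: f1_gt0.
  have r1 : 1 <= r by rewrite /r lerDl oppr_ge0 ler_pdivrMr// mul0r ltW// f_neg.
  have [s] := MVT_segment r1 (fun x _ => (der1_even_profile x).1) (@f_cont _ _).
  rewrite in_itv/= => /andP[s1 sr] fr.
  have f1s : f1 1 <= f1 s.
    apply: (@der1_ge0_le _ f1 f2 _ _ s1 (@f1_cont _ _)).
      by move=> x _; case: (der1_even_profile x).
    by move=> x /andP[x1 _]; apply: ltW; apply: f2_gt0; exact: lt_trans ltr01 x1.
  have : f r < 0 by apply: f_neg; exact: le_trans ler01 r1.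
  have : f1 1 * (r - 1) <= f1 s * (r - 1) by rewrite ler_wpM2r// subr_ge0.
  rewrite -fr {1}/r (_ : f1 1 * _ = - f 1); first by lra.
  by field; rewrite gt_eqF.
have f_gt0 r : 0 <= r -> 0 < f r by move=> r0; rewrite -fsign.
have C0 : 0 < C.
  rewrite -invr_gt0 -(bC c c0); apply: mulr_gt0 (p0 c c0).
  exact: mulr_gt0 (f_gt0 c (ltW c0)) f2c.
exists C; split; [exact: C0|exact: aC|exact: f0|move=> r r0].
have [df df1] := der1_even_profile r.
by split; [| |exact: f_gt0 (ltW r0)|exact: f1_gt0|exact: bC].
Qed.

Lemma separated_w_continuous a : {within `[a, 0], continuous w}.
Proof.
have phi0 := separated_phi_neq0 (lexx 0).
have [/subspace_continuousP cu _ _] := u_pconvex.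
have wE t : t <= 0 -> u (0, t) / phi 0 = w t.
  by move=> t0; rewrite u_separated// enorm0 mulfK.
apply/subspace_continuousP => t; rewrite /= in_itv/= => /andP[at_ t0].
have cpair : ((0 : 'rV[R]_n), s) @[s --> t] --> ((0 : 'rV[R]_n), t).
  apply: (@cvg_pair _ _ _ _ (nbhs (0 : 'rV[R]_n)) (nbhs t)); first exact: cvg_cst.
  exact: cvg_id.
have cut : u (0, s) @[s --> within `[a, 0] (nbhs t)] --> u (0, t).
  move=> B /(cu (0, t) t0) /cpair cB.
  have {}cB : nbhs t (fun s => s <= 0 -> B (u (0, s))) by exact: cB.
  change (nbhs t (fun s => `[a, 0]%classic s -> B (u (0, s)))).
  apply: filterS cB => s /= Bs; rewrite in_itv/= => /andP[_ s0]; exact: Bs.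
have lim : u (0, s) / phi 0 @[s --> within `[a, 0] (nbhs t)] --> u (0, t) / phi 0.
  by apply: cvgM; [exact: cut|exact: cvg_cst].
rewrite (wE t t0) in lim; apply: (near_cvg _ _ lim).
apply: (filterS _ (withinT _ _)) => s.
by rewrite /= in_itv/= => /andP[_ /wE].
Qed.

(** (w ^ (n + 1))' = - (n + 1) C, so w ^ (n + 1) is affine; the time shift T
    moves its zero to 0. *)
Lemma time_factor C : 0 < C -> (forall t, t < 0 -> - derive1 w t * w t ^+ n = C) ->
  exists2 T, 0 <= T & forall t, t <= 0 ->
    w t = C `^ n.+1%:R^-1 * (n.+1%:R * (T - t)) `^ n.+1%:R^-1.
Proof.
move=> C0 wC.
have wpos t : t < 0 -> 0 < w t.
  move=> t0; have N10 : -1 < 0 :> R by rewrite ltrN10.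
  have cw a b : b < 0 -> {within `[a, b], continuous w}.
    move=> b0; apply: der1_within_continuous => s /andP[_ sb].
    by apply: der1_separated_w; exact: le_lt_trans b0.
  have neq0 a b : b < 0 -> forall s, a <= s <= b -> w s != 0.
    by move=> b0 s /andP[_ sb]; rewrite separated_w_neq0// (le_lt_trans sb).
  have [tN1|/ltW tN1] := leP t (-1).
    by rewrite (nonvanishing_same_sign tN1 (@cw _ _ N10) (neq0 _ _ N10)).
  by rewrite -(nonvanishing_same_sign tN1 (@cw _ _ t0) (neq0 _ _ t0)).
have w0 : 0 <= w 0.
  rewrite leNgt; apply/negP => w0neg.
  have N10 : -1 <= 0 :> R by rewrite lerN10.
  have w_neq0 s : -1 <= s <= 0 -> w s != 0.
    move=> /andP[_]; rewrite le_eqVlt => /predU1P[->|]; first by rewrite lt_eqF.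
    exact: separated_w_neq0.
  have := nonvanishing_same_sign N10 (@separated_w_continuous (-1)) w_neq0.
  by rewrite w_pos => /esym; rewrite ltNge (ltW w0neg).
have k0 : 0 < n.+1%:R * C by rewrite mulr_gt0.
exists (w 0 ^+ n.+1 / (n.+1%:R * C)); first by rewrite divr_ge0 ?exprn_ge0// ltW.
move=> t t0.
have wt0 : 0 <= w t.
  by move: t0; rewrite le_eqVlt => /predU1P[->//|/wpos/ltW].
have wE : w t ^+ n.+1 = w 0 ^+ n.+1 - n.+1%:R * C * t.
  pose D s := w s ^+ n.+1 + n.+1%:R * C * s.
  have dlin s : der1 (fun s => n.+1%:R * C * s) s (n.+1%:R * C * 1 + s * 0).
    by apply: der1M; [exact: der1_cst|exact: der1_id].
  have clin := der1_within_continuous (fun s (_ : t <= s <= 0) => dlin s).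
  suff : `|D 0 - D t| <= 0 - 0.
    by rewrite subrr normr_le0 /D mulr0 addr0 subr_eq0 => /eqP ->; rewrite addrK.
  apply: (@der1_le_norm _ D (fun=> 0) (fun=> 0) (fun=> 0) _ _ t0).
  - move=> s; apply: cvgD.
      apply: (@cvg_comp _ _ _ w (fun y => y ^+ n.+1)); last exact: exprn_continuous.
      exact: separated_w_continuous.
    exact: clin.
  - by move=> x; exact: cvg_cst.
  - move=> s /andP[_ s0]; apply: der1_eq.
      by apply: der1D (dlin s); apply: der1X; exact: der1_separated_w.
    by rewrite -(wC _ s0) /=; ring.
  - by move=> x _; exact: der1_cst.
  - by move=> x _; rewrite normr0.
rewrite -powRM ?(ltW C0)//; last first.
  by rewrite mulr_ge0// subr_ge0 (le_trans t0)// divr_ge0 ?exprn_ge0// ltW.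
have -> : C * (n.+1%:R * (w 0 ^+ n.+1 / (n.+1%:R * C) - t)) = w t ^+ n.+1.
  have C00 : C != 0 by rewrite gt_eqF.
  have : n.+1%:R != 0 :> R by rewrite pnatr_eq0.
  by rewrite wE; move: (n.+1%:R) (w 0 ^+ n.+1) => N W N0; field; rewrite C00 N0.
by rewrite -powR_mulrn// -powRrM divff ?pnatr_eq0// powRr1.
Qed.

End PositiveTimeFactor.
End Separated.

(** * Normalization and limits *)

Lemma u0_constantE (R : realType) (n : nat) : (2 <= n)%N ->
  (n.+1%:R ^+ n.+2 / ((2 * n%:R) ^+ n * (n%:R - 1))) `^ n.+1%:R^-1
  = n.+1%:R `^ n.+1%:R^-1 * phi_asymp_const R n.
Proof.
move=> n2; have n0 : 0 <= n%:R - 1 :> R by rewrite subr_ge0 ler1n ltnW.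
have d0 : 0 <= (2 * n%:R) ^+ n * (n%:R - 1) :> R.
  by rewrite mulr_ge0 ?exprn_ge0 ?mulr_ge0.
rewrite powRM ?invr_ge0 ?exprn_ge0// exprS powRM ?exprn_ge0//.
rewrite -[_ ^+ n.+1]powR_mulrn// -powRrM divff ?pnatr_eq0// powRr1// -mulrA.
congr (_ * (_ * _)).
rewrite -[(_ * _)^-1]powR_inv1// -powRrM mulN1r powRN; congr (_^-1).
rewrite [in LHS]powRM ?exprn_ge0 ?mulr_ge0//.
by rewrite -[(2 * n%:R) ^+ n]powR_mulrn ?mulr_ge0// -powRrM.
Qed.

Lemma phi_asymp_const_gt0 (R : realType) (n : nat) : (2 <= n)%N ->
  0 < phi_asymp_const R n.
Proof.
move=> n2; have n0 : 0 < n%:R :> R by rewrite ltr0n ltnW.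
have n1 : 0 < n%:R - 1 :> R by rewrite subr_gt0 ltr1n.
by apply: divr_gt0; rewrite ?ltr0n// mulr_gt0 ?powR_gt0// mulr_gt0.
Qed.

Lemma at_infinity_enorm (R : realType) (n : nat) :
  enorm x @[x --> @at_infinity R n] --> +oo.
Proof. by move=> A [M [_ MA]]; exists M => // x; exact: MA. Qed.

Theorem theorem1p3 (R : realType) (n : nat) (u : 'rV[R]_n * R -> R)
    (w phi : R -> R)
    (n_ge2 : (2 <= n)%N)
    (u_smooth : smooth_on [set p : 'rV[R]_n * R | p.2 < 0] u)
    (u_pconvex : parabolically_convex u)
    (u_solution : parabolic_MA_solution u)
    (u_separated : forall (x : 'rV[R]_n) (t : R), t <= 0 -> u (x, t) = w t * phi (enorm x)) :
  exists phi1 : R -> R,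
    [/\ is_phi1 n phi1,
        forall psi, is_phi1 n psi -> {in `[0, +oo[, psi =1 phi1}
      & exists (s : bool) (C a b T : R) (wN phiN : R -> R),
        [/\ normalization n s C a b T w phi wN phiN,
            (forall (x : 'rV[R]_n) (t : R), t <= 0 ->
               separated_fun wN phiN (x, t) = u1 phi1 (x, t)) /\
            (forall (x : 'rV[R]_n) (t : R), t <= 0 ->
               u (x, t) = a * u1 phi1 (b^-1 *: x, t - T)),
            (forall t : R, t <= 0 ->
               wN t = n.+1%:R `^ n.+1%:R^-1 * (- t) `^ n.+1%:R^-1),
            phiN r / r `^ (2 * n%:R / n.+1%:R) @[r --> +oo]
              --> phi_asymp_const R n /\
            (forall t : R, t < 0 ->
               separated_fun wN phiN (x, t) / u0 (x, t) @[x --> @at_infinity R n]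
                 --> (1 : R))
          & derive1 phiN r
              / (2 * n%:R / n.+1%:R * r `^ ((n%:R - 1) / n.+1%:R)) @[r --> +oo]
              --> phi_asymp_const R n /\
            derive1 (derive1 phiN) r
              / (2 * n%:R * (n%:R - 1) / n.+1%:R ^+ 2
                 * r `^ (- 2 / n.+1%:R)) @[r --> +oo]
              --> phi_asymp_const R n]].
Proof.
(* with this sign the time factor is positive *)
pose s := w (-1) < 0.
pose ws t := (-1) ^+ s * w t; pose phis r := (-1) ^+ s * phi r.
have us x t : t <= 0 -> u (x, t) = ws t * phis (enorm x).
  by move=> t0; rewrite u_separated// /ws /phis mulrACA -signr_addb addbb mul1r.
have N10 : -1 < 0 :> R by rewrite ltrN10.
have ws0 : 0 < ws (-1).
  rewrite /ws /s -normrEsign ?num_real// normr_gt0.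
  exact: (separated_w_neq0 n_ge2 u_solution u_separated).
have [C [C0 wC f0 feq]] :=
  separation_constant n_ge2 u_smooth u_pconvex u_solution us ws0.
have [T T0 wT] := time_factor n_ge2 u_smooth u_pconvex u_solution us ws0 C0 wC.
set f := even_profile u ws n_ge2 in f0 feq.
have fE r : f r = phis `|r| by exact: (even_profileE n_ge2 u_solution us).
have df := der1_even_profile ws n_ge2 u_smooth.
rewrite -/f in df.
have f'0 : derive1 f 0 = 0 := even_profile_der0 n_ge2 u_smooth u_solution us.
have n0 : (0 < n)%N := ltnW n_ge2.
pose k := C `^ n.+1%:R^-1.
have k0 : 0 < k by rewrite powR_gt0.
have kC : k ^+ n.+1 = C.
  by rewrite -powR_mulrn ?powR_ge0// -powRrM mulVf ?pnatr_eq0// powRr1// ltW.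
(* the normalized profile g must be 1 at 0, which fixes a; then b is forced by
   the scaling symmetry *)
pose a := k * f 0; pose b := a `^ (n.+1%:R / (2 * n)%:R).
have a0 : 0 < a by rewrite mulr_gt0.
have b0 : 0 < b by rewrite powR_gt0.
have ab : a ^+ n.+1 = b ^+ (2 * n).
  rewrite -[RHS]powR_mulrn ?powR_ge0// -powRrM divfK ?powR_mulrn// ?ltW//.
  by rewrite pnatr_eq0 muln_eq0/= -lt0n.
pose c := k / a.
have c0 : 0 < c by rewrite divr_gt0.
pose g r := c * f (b * r).
pose g1 r := c * b * derive1 f (b * r).
pose g2 r := c * b ^+ 2 * derive1 (derive1 f) (b * r).
have dg r : der1 g r (g1 r) by apply: der1_scale; exact: (df _).1.
have dg1 r : der1 g1 r (g2 r).
  by apply: der1_eq; [apply: der1_scale; exact: (df _).2|rewrite /g2 expr2; ring].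
have g1E : derive1 g = g1 by apply/funext => r; exact: der1E.
have g2E : derive1 g1 = g2 by apply/funext => r; exact: der1E.
have geq : profile_equation n g g1 g2 1.
  suff -> : 1 = c ^+ n.+1 * b ^+ (2 * n) * C^-1 by exact: profile_equation_scale.
  by rewrite -ab /c expr_div_n kC; field; rewrite expf_neq0 ?gt_eqF.
have g_0 : g 0 = 1.
  by rewrite /g mulr0 /c /a; field; rewrite !gt_eqF.
have gE r : 0 <= r -> g r = a^-1 * (k * phis (b * r)).
  by move=> r0; rewrite /g fE ger0_norm ?mulr_ge0 ?(ltW b0)// /c; ring.
have gphi1 : is_phi1 n g.
  apply: (profile_is_phi1 n0 geq) => //.
  - exact: der1_continuous (dg 0).
  - exact: der1_continuous (dg1 0).
  - by rewrite /g1 mulr0 f'0 mulr0.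
exists g; split; first exact: gphi1.
  by move=> psi psi1; exact: (is_phi1_unique n0 psi1 gphi1).
pose wN t : R := n.+1%:R `^ n.+1%:R^-1 * (- t) `^ n.+1%:R^-1.
have wNE t : t <= 0 -> wN t = (- (n.+1%:R * t)) `^ n.+1%:R^-1.
  by move=> t0; rewrite /wN -powRM ?oppr_ge0// mulrN.
have wNT t : t <= 0 -> ws t = k * wN (t - T).
  by move=> t0; rewrite wT// /wN opprB powRM// subr_ge0 (le_trans t0).
exists s, C, a, b, T, wN, g; split.
- split=> //.
  + split=> //; split=> [t t0|r r0].
      split; last exact: wC.
      by case: (der1_separated_w n_ge2 u_smooth u_solution us t0).
    have near_pos (h h' : R -> R) (x : R) : (forall y, 0 < y -> h y = h' y) -> 0 < x ->
        \forall y \near x, h y = h' y.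
      by move=> hh' x0; apply: (filterS _ (lt_nbhsr x0)) => y; exact: hh'.
    have dphis x : 0 < x -> der1 phis x (derive1 f x).
      move=> x0; apply: near_der1 (df x).1; apply: near_pos x0 => y y0.
      by rewrite fE gtr0_norm.
    have ddphis : der1 (derive1 phis) r (derive1 (derive1 f) r).
      apply: near_der1 (df r).2; apply: near_pos r0 => y y0.
      by rewrite (der1E (dphis y y0)).
    have [_ _ _ _ eqr] := feq r r0.
    split; [by case: (dphis r r0)|by case: ddphis|].
    rewrite (der1E (dphis r r0)) (der1E ddphis) -eqr fE gtr0_norm//.
  + by move=> t t0; rewrite -/(ws t) wNT// powRN -/k mulKf ?gt_eqF.
  + by split=> //; rewrite /wN oppr0 powR0 ?mulr0// invr_neq0 ?pnatr_eq0.
- split=> x t t0.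
    by rewrite /u1 /separated_fun /= wNE.
  have tT : t - T <= 0 by rewrite subr_le0 (le_trans t0).
  rewrite us// wNT// /u1 /separated_fun/= -wNE//.
  rewrite enormZ gtr0_norm ?invr_gt0// gE ?mulr_ge0 ?invr_ge0 ?enorm_ge0 ?(ltW b0)//.
  by rewrite mulVKf ?gt_eqF//; field; rewrite gt_eqF.
- by [].
- have gl := profile_cvg n_ge2 geq; split; first exact: gl.
  move=> t t0.
  pose H r := wN t * g r / ((n.+1%:R `^ n.+1%:R^-1 * phi_asymp_const R n)
    * (- t) `^ n.+1%:R^-1 * r `^ (2 * n%:R / n.+1%:R)).
  have -> : (fun x => separated_fun wN g (x, t) / u0 (x, t)) = H \o @enorm R n.
    by apply/funext => x; rewrite /separated_fun /u0 u0_constantE.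
  apply: cvg_comp (@at_infinity_enorm R n) _.
  (* the constant factors of u0 are those of wN and the limit of g *)
  have cst0 : phi_asymp_const R n != 0 by rewrite gt_eqF// phi_asymp_const_gt0.
  have lim : (phi_asymp_const R n)^-1 * (g r / r `^ (2 * n%:R / n.+1%:R))
      @[r --> +oo] --> (phi_asymp_const R n)^-1 * phi_asymp_const R n.
    by apply: cvgM; [exact: cvg_cst|exact: gl].
  rewrite mulVf// in lim; apply: (near_cvg _ _ lim); near=> r.
  have r0 : 0 < r by near: r; exact: nbhs_pinfty_gt.
  have r'0 : r `^ (2 * n%:R / n.+1%:R) != 0 by rewrite gt_eqF ?powR_gt0.
  have t'0 : (- t) `^ n.+1%:R^-1 != 0 by rewrite gt_eqF ?powR_gt0 ?oppr_gt0.
  have N'0 : n.+1%:R `^ n.+1%:R^-1 != 0 :> R by rewrite gt_eqF ?powR_gt0.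
  rewrite /H /wN; move: (_ `^ _) (_ `^ _) (_ `^ _) r'0 t'0 N'0 => X Y Z X0 Y0 Z0.
  by field; rewrite X0 Y0 Z0 cst0.
- rewrite g1E g2E; split.
    exact: (profile_der_cvg n_ge2 geq).
  have := profile_der2_cvg n_ge2 geq.
  have -> : growth_exponent R n * slope_exponent R n
      = 2 * n%:R * (n%:R - 1) / n.+1%:R ^+ 2.
    rewrite /growth_exponent /slope_exponent expr2.
    have : n.+1%:R != 0 :> R by rewrite pnatr_eq0.
    by move: (n.+1%:R) => N N0; field.
  have -> : slope_exponent R n - 1 = - 2 / n.+1%:R :> R.
    have nE : n%:R = n.+1%:R - 1 :> R by rewrite -natr1 addrK.
    have : n.+1%:R != 0 :> R by rewrite pnatr_eq0.
    by rewrite /slope_exponent nE; move: (n.+1%:R) => N N0; field.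
  exact.
Unshelve. all: by end_near. Qed.
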